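(* Let $(M^1,\nabla^1,h^1)$ and $(M^2,\nabla^2,h^2)$ be K-V manifolds. For a smooth map $F:M^1\to M^2$ the following conditions are equivalent: (i) $F$ is a K-V map. (ii) $\mathrm{Graph}(F)\subset M^1\times\overline{M}^2$ is a coisotropic K-V submanifold.
   Context: An affine manifold $(M,\nabla)$ is a manifold with a flat torsion-free connection $\nabla$ on $TM$. For a symmetric bivector field $h$ on $M$, let $h_\#:T^*M\to TM$, $\alpha\mapsto\alpha^\#$, be defined by $\beta(\alpha^\#)=h(\alpha,\beta)$. The triple $(M,\nabla,h)$ is a Koszul-Vinberg (K-V) manifold if $(\nabla_{\alpha^\#}h)(\beta,\gamma)=(\nabla_{\beta^\#}h)(\alpha,\gamma)$ for all $\alpha,\beta,\gamma\in\Omega^1(M)$. A smooth map between affine manifolds is affine if it maps vector fields parallel along a curve to vector fields parallel along the image curve (equivalently, maps geodesics to geodesics). A K-V map $F:(M^1,\nabla^1,h^1)\to(M^2,\nabla^2,h^2)$ is an affine map with $h^1(F^*\alpha,F^*\beta)=h^2(\alpha,\beta)\circ F$ for all $\alpha,\beta\in\Omega^1(M^2)$. $M^1\times\overline{M}^2$ denotes the K-V manifold $(M^1\times M^2,\nabla^1\oplus\nabla^2,h^1\oplus(-h^2))$, i.e. the one such that the projections onto $(M^1,\nabla^1,h^1)$ and $(M^2,\nabla^2,-h^2)$ are K-V maps. An affine submanifold $N$ of $(M,\nabla)$ is a submanifold with a flat torsion-free connection such that the inclusion is affine; equivalently, parallel transport of $M$ along curves in $N$ preserves $TN$. A coisotropic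 K-V submanifold of $(M,\nabla,h)$ is an affine submanifold $N\subset M$ with $h_\#(TN^\circ)\subset TN$, where $TN^\circ\subset T^*M|_N$ is the annihilator of $TN$. *)

(* Defs.v *)
From HB Require Import structures.
From mathcomp Require Import all_boot all_order all_algebra.
From mathcomp Require Import all_classical all_reals.
From mathcomp Require Import set_interval topology normedtype landau derive.

Set Implicit Arguments.
Unset Strict Implicit.
Unset Printing Implicit Defensive.

Import Order.TTheory GRing.Theory Num.Theory.
Import numFieldNormedType.Exports.

Local Open Scope classical_set_scope.
Local Open Scope ring_scope.

Section SmoothFunctions.
Context {R : realType}.

(* [U] is meant to be open. *)
Fixpoint Ck_on (V W : normedModType R) (k : nat) (U : set V) (f : V -> W)
    : Prop :=
  match k with
  | 0 => forall x, U x -> {for x, continuous f}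
  | k'.+1 => (forall x, U x -> differentiable f x) /\
             (forall v, Ck_on k' U ('D_v f))
  end.

Definition smooth_on (V W : normedModType R) (U : set V) (f : V -> W) :=
  forall k, Ck_on k U f.

End SmoothFunctions.


Section SmoothCalculus.
Context {R : realType}.

Lemma continuous_linear_mx (m n : nat) (W : normedModType R)
  (f : {linear 'M[R]_(m, n) -> W}) : continuous f.
Proof.
have -> : (f : _ -> _) = fun x => \sum_i \sum_j x i j *: f (delta_mx i j).
  apply/funext => x; rewrite {1}[x]matrix_sum_delta raddf_sum.
  apply: eq_bigr => i _; rewrite raddf_sum; apply: eq_bigr => j _.
  exact: linearZ.
move=> x; apply: continuous_big => [|i _]; first exact: add_continuous.
apply: continuous_big => [|j _]; first exact: add_continuous.
by move=> y; apply: (@cvgZr_tmp _ _ _ (nbhs y)); exact: coord_continuous.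
Qed.

Lemma differentiable_ext (V W : normedModType R) (f g : V -> W) x :
  {near x, f =1 g} -> differentiable f x -> differentiable g x.
Proof.
move=> fg /diff_locallyP [cf /eqaddoP df].
have E : \forall h \near (0 : V), g (h + x) = f (h + x).
  rewrite (near_shift x) /=; apply: filterS fg => y fgy; rewrite /= sub0r subrK. exact: esym.
have gf : g \o shift x = cst (g x) + 'd f x +o_ 0 id.
  apply/eqaddoP => e e0; have := df e e0; apply: filterS2 E => h.
  rewrite /= !fctE /= => ->.
  by rewrite (nbhs_singleton fg).
have dE := diff_unique cf gf.
by apply/diff_locallyP; rewrite dE; split.
Unshelve. all: by end_near. Qed.

Lemma Ck_on_ext (V W : normedModType R) k (U : set V) (f g : V -> W) :
  open U -> (forall x, U x -> f x = g x) -> Ck_on k U f -> Ck_on k U g.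
Proof.
move=> oU; have nearU x : U x -> (forall x, U x -> f x = g x) -> {near x, f =1 g}.
  move=> Ux fg; have : nbhs x U by apply: open_nbhs_nbhs.
  by apply: filterS => y /fg.
elim: k f g nearU => [|k IH] f g nearU fg /=.
  move=> cf x Ux; have n := nearU x Ux fg.
  have -> : {for x, continuous g} = (g @ x --> f x) by rewrite (fg x Ux).
  by apply: cvg_trans (cf x Ux); apply: near_eq_cvg; apply: filterS n => y ->.
move=> [df Cf]; split => [x Ux|v].
  by apply: differentiable_ext (df x Ux); exact: nearU.
apply: IH (Cf v) => // [x Ux _|x Ux]; last exact/near_eq_derive/nearU.
have : nbhs x U by apply: open_nbhs_nbhs.
by apply: filterS => y Uy; apply/near_eq_derive/nearU.
Qed.

Lemma smooth_on_ext (V W : normedModType R) (U : set V) (f g : V -> W) :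
  open U -> (forall x, U x -> f x = g x) -> smooth_on U f -> smooth_on U g.
Proof. by move=> oU fg sf k; exact: Ck_on_ext (sf k). Qed.

Lemma derive_lin_comp (V V' W W' : normedModType R) (A : {linear W -> W'})
    (B : {linear V' -> V}) (f : V -> W) x v :
  continuous A -> continuous B -> differentiable f (B x) ->
  differentiable (A \o f \o B) x /\
  'D_v (A \o f \o B) x = A ('D_(B v) f (B x)).
Proof.
move=> cA cB df.
have dA y : differentiable A y by exact: linear_differentiable.
have dB y : differentiable B y by exact: linear_differentiable.
have dAf : differentiable (A \o f) (B x) by exact: differentiable_comp.
have dAfB : differentiable (A \o f \o B) x by exact: differentiable_comp.
split=> //; rewrite !deriveE // diff_comp //= diff_comp //=.
by rewrite (diff_lin _ cA) (diff_lin _ cB).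
Qed.

Lemma Ck_on_lin_comp (V V' W W' : normedModType R) (A : {linear W -> W'})
    (B : {linear V' -> V}) k (U : set V) (U' : set V') (f : V -> W) :
  continuous A -> continuous B -> open U' -> (forall x, U' x -> U (B x)) ->
  Ck_on k U f -> Ck_on k U' (A \o f \o B).
Proof.
move=> cA cB oU' UU'; elim: k f => [|k IH] f /=.
  move=> cf x Ux; apply: continuous_comp; first exact: cB.
  by apply: continuous_comp; [exact/cf/UU'|exact: cA].
move=> [df Cf]; split => [x Ux|v].
  by have [] := derive_lin_comp 0 cA cB (df _ (UU' _ Ux)).
apply: Ck_on_ext (IH _ (Cf (B v))) => // x Ux /=.
by have [_ ->] := derive_lin_comp v cA cB (df _ (UU' _ Ux)).
Qed.

Lemma Ck_on_add (V W : normedModType R) k (U : set V) (f g : V -> W) :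
  open U -> Ck_on k U f -> Ck_on k U g -> Ck_on k U (f + g).
Proof.
move=> oU; elim: k f g => [|k IH] f g /=.
  by move=> cf cg x Ux; apply: continuousD; [exact: cf|exact: cg].
move=> [df Cf] [dg Cg]; split => [x Ux|v].
  by apply: differentiableD; [exact: df|exact: dg].
apply: Ck_on_ext (IH _ _ (Cf v) (Cg v)) => // x Ux.
by rewrite deriveD //; apply: diff_derivable; [exact: df|exact: dg].
Qed.

Lemma Ck_on_0 (V W : normedModType R) k (U : set V) :
  open U -> Ck_on k U (0 : V -> W).
Proof.
move=> oU; elim: k => [|k IH] /=; first by move=> x _; exact: cvg_cst.
split => [x _|v]; first exact: (differentiable_cst 0).
by apply: Ck_on_ext IH => // x _; rewrite (derive_cst (0 : W)).
Qed.

Lemma smooth_on_sum (V W : normedModType R) (I : finType) (U : set V)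
    (f : I -> V -> W) :
  open U -> (forall i, smooth_on U (f i)) -> smooth_on U (\sum_i f i).
Proof.
move=> oU sf k; elim/big_ind: _ => [|g h Cg Ch|i _]; first exact: Ck_on_0.
  exact: Ck_on_add.
exact: sf.
Qed.

Lemma jacobian_sum (m n : nat) (f : 'rV[R]_m -> 'rV[R]_n) x :
  differentiable f x ->
  'J f x = \sum_i delta_mx i 0 *m 'D_(delta_mx 0 i) f x.
Proof.
move=> df; apply/matrixP => i j; rewrite summxE (bigD1 i) //= big1 => [|k ki].
  rewrite addr0 deriveEjacobian // -rowE !mxE big_ord1 !mxE !eqxx mul1r.
  by [].
by rewrite !mxE big_ord1 !mxE eq_sym (negbTE ki) mul0r.
Qed.

Lemma smooth_on_jacobian (m n : nat) (U : set 'rV[R]_m)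
    (f : 'rV[R]_m -> 'rV[R]_n) :
  open U -> smooth_on U f -> smooth_on U (jacobian f).
Proof.
move=> oU sf.
have df x : U x -> differentiable f x by have [+ _] := sf 1%N; apply.
apply: (@smooth_on_ext _ 'M[R]_(m, n) U
  (\sum_i (fun x => delta_mx i 0 *m 'D_(delta_mx 0 i) f x))) => // [x Ux|].
  by rewrite jacobian_sum ?fct_sumE //; exact: df.
apply: smooth_on_sum => // i k.
apply: (@Ck_on_lin_comp 'rV[R]_m 'rV[R]_m 'rV[R]_n 'M[R]_(m, n)
  (mulmx (delta_mx i 0)) idfun k U U ('D_(delta_mx 0 i) f)) => //.
- exact: continuous_linear_mx.
- by move=> x; exact: cvg_id.
- by have [_] := sf k.+1; apply.
Qed.

End SmoothCalculus.

(* A homeomorphism from an open subset of [T] onto an open subset of R^n; the  *)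
(* values of [chart_map] and [chart_inv] outside these subsets are irrelevant. *)
Record chart (R : realType) (n : nat) (T : topologicalType) := Chart {
  chart_dom : set T;
  chart_map :> T -> 'rV[R]_n;
  chart_inv : 'rV[R]_n -> T;
  chart_dom_open : open chart_dom;
  chart_im_open : open (chart_map @` chart_dom);
  chart_mapK : forall p, chart_dom p -> chart_inv (chart_map p) = p;
  chart_map_cont : forall p, chart_dom p -> {for p, continuous chart_map};
  chart_inv_cont : forall x, (chart_map @` chart_dom) x ->
    {for x, continuous chart_inv}
}.

Section Charts.
Context {R : realType} {n : nat} {T : topologicalType}.
Implicit Types phi psi : chart R n T.

Definition chart_im phi : set 'rV[R]_n := phi @` chart_dom phi.

Definition overlap phi psi : set 'rV[R]_n :=
  phi @` (chart_dom phi `&` chart_dom psi).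

Definition transition phi psi : 'rV[R]_n -> 'rV[R]_n := psi \o chart_inv phi.

End Charts.

(* Smooth manifolds of dimension [n].  The chart [chart_at p] around [p] is    *)
(* only used to identify the tangent space at [p] with R^n.                    *)
Record manifold (R : realType) (n : nat) := Manifold {
  point_of :> topologicalType;
  chart_index : Type;
  atlas : chart_index -> chart R n point_of;
  chart_at : point_of -> chart_index;
  mem_chart_at : forall p, chart_dom (atlas (chart_at p)) p;
  atlas_compat : forall i j,
    smooth_on (overlap (atlas i) (atlas j)) (transition (atlas i) (atlas j));
  manifold_hausdorff : hausdorff_space point_of;
  manifold_second_countable : @second_countable point_of
}.

Section Manifolds.
Context {R : realType} {n : nat} (M : manifold R n).
Implicit Types (p : M) (i j : chart_index M).

(* Tangent and cotangent vectors at [p] are given by their components in the   *)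
(* chart [chart_at p]: rows for vectors and columns for covectors, so that     *)
(* [v *m a] is the duality pairing.                                            *)
Definition tangent p := 'rV[R]_n.
Definition cotangent p := 'cV[R]_n.

Definition annihilator p (T : set (tangent p)) : set (cotangent p) :=
  [set a | forall v, T v -> v *m a = 0].

Definition change i j p : 'M[R]_n :=
  'J (transition (atlas i) (atlas j)) (atlas i p).

Definition tangent_coord p i (v : tangent p) : 'rV[R]_n :=
  v *m change (chart_at p) i p.

Definition cotangent_coord p i (a : cotangent p) : 'cV[R]_n :=
  change i (chart_at p) p *m a.

Definition bivector_coord p i (h : 'M[R]_n) : 'M[R]_n :=
  (change (chart_at p) i p)^T *m h *m change (chart_at p) i p.

Record one_form := OneForm {
  form_at :> forall p, cotangent p;
  form_smooth : forall i, smooth_on (chart_im (atlas i)) (fun x =>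
    cotangent_coord i (form_at (chart_inv (atlas i) x)))
}.

(* [bivector_at p] is the Gram matrix of the form h_p on the cotangent space.  *)
Record bivector := Bivector {
  bivector_at :> M -> 'M[R]_n;
  bivector_sym : forall p, (bivector_at p)^T = bivector_at p;
  bivector_smooth : forall i, smooth_on (chart_im (atlas i)) (fun x =>
    bivector_coord (chart_inv (atlas i) x) i (bivector_at (chart_inv (atlas i) x)))
}.

Definition bilin m (h : 'M[R]_m) (a b : 'cV[R]_m) : R := (a^T *m h *m b) 0 0.

(* b (sharp h a) = h (a, b) *)
Definition sharp m (h : 'M[R]_m) (a : 'cV[R]_m) : 'rV[R]_m := a^T *m h.

(* A connection on TM, given by its connection forms in the coordinate frames: *)
(* at the point with coordinates [x] in the chart [i],                         *)
(*   nabla_u Y = 'D_u Y x + Y x *m omega i x u,                                *)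
(* i.e. the Christoffel symbols Gamma^l_kj are the entries (j, l) of           *)
(* [omega i x (delta_mx 0 k)].  [omega_gauge] is the change of frame formula,  *)
(* which says that this does not depend on [i].                                *)
Record connection := Connection {
  omega :> chart_index M -> 'rV[R]_n -> 'rV[R]_n -> 'M[R]_n;
  omega_linear : forall i x, chart_im (atlas i) x -> linear (omega i x);
  omega_smooth : forall i u, smooth_on (chart_im (atlas i)) (omega i ^~ u);
  omega_gauge : forall i j x u, overlap (atlas i) (atlas j) x ->
    let tau := transition (atlas i) (atlas j) in
    'D_u (jacobian tau) x + 'J tau x *m omega j (tau x) (u *m 'J tau x)
      = omega i x u *m 'J tau x
}.

Section LocalCalculus.
Variable D : connection.

(* Vector fields on the domain of the chart [i], in coordinates.               *)
Definition nabla i (X Y : 'rV[R]_n -> 'rV[R]_n) (x : 'rV[R]_n) : 'rV[R]_n :=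
  'D_(X x) Y x + Y x *m D i x (X x).

Definition bracket (X Y : 'rV[R]_n -> 'rV[R]_n) (x : 'rV[R]_n) : 'rV[R]_n :=
  'D_(X x) Y x - 'D_(Y x) X x.

Definition torsion_free := forall i (X Y : 'rV[R]_n -> 'rV[R]_n),
  smooth_on (chart_im (atlas i)) X -> smooth_on (chart_im (atlas i)) Y ->
  forall x, chart_im (atlas i) x ->
  nabla i X Y x - nabla i Y X x = bracket X Y x.

Definition flat := forall i (X Y Z : 'rV[R]_n -> 'rV[R]_n),
  smooth_on (chart_im (atlas i)) X -> smooth_on (chart_im (atlas i)) Y ->
  smooth_on (chart_im (atlas i)) Z ->
  forall x, chart_im (atlas i) x ->
  nabla i X (nabla i Y Z) x - nabla i Y (nabla i X Z) x
    - nabla i (bracket X Y) Z x = 0.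

Definition affine_structure := torsion_free /\ flat.

Definition form_local (a : one_form) i (x : 'rV[R]_n) : 'cV[R]_n :=
  cotangent_coord i (a (chart_inv (atlas i) x)).

Definition bivector_local (h : bivector) i (x : 'rV[R]_n) : 'M[R]_n :=
  bivector_coord (chart_inv (atlas i) x) i (h (chart_inv (atlas i) x)).

(* (nabla_u b)(Y) = u.b(Y) - b(nabla_u Y) *)
Definition nabla_form i (u : 'rV[R]_n) (b : 'rV[R]_n -> 'cV[R]_n)
    (x : 'rV[R]_n) : 'cV[R]_n :=
  'D_u b x - D i x u *m b x.

(* (nabla_u h)(b, c) = u.h(b, c) - h(nabla_u b, c) - h(b, nabla_u c) *)
Definition nabla_bivector (h : bivector) i (u : 'rV[R]_n) (b c : one_form)
    (x : 'rV[R]_n) : R :=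
  'D_u (fun y => bilin (bivector_local h i y)
                       (form_local b i y) (form_local c i y) : R^o) x
  - bilin (bivector_local h i x)
      (nabla_form i u (form_local b i) x) (form_local c i x)
  - bilin (bivector_local h i x)
      (form_local b i x) (nabla_form i u (form_local c i) x).

Definition koszul_vinberg (h : bivector) :=
  affine_structure /\
  forall (a b c : one_form) i x, chart_im (atlas i) x ->
    nabla_bivector h i (sharp (bivector_local h i x) (form_local a i x)) b c x
    = nabla_bivector h i (sharp (bivector_local h i x) (form_local b i x)) a c x.

End LocalCalculus.

Definition smooth_curve (a b : R) (c : R -> M) :=
  (forall t, a < t < b -> {for t, continuous c}) /\
  forall i, smooth_on (`]a, b[ `&` c @^-1` chart_dom (atlas i))
                      (atlas i \o c : R^o -> 'rV[R]_n).

Definition field_local (c : R -> M) (V : forall t, tangent (c t)) i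
  : R^o -> 'rV[R]_n := fun t => tangent_coord i (V t).

Definition parallel_along (D : connection) (a b : R) (c : R -> M)
    (V : forall t, tangent (c t)) :=
  (forall i, smooth_on (`]a, b[ `&` c @^-1` chart_dom (atlas i))
                       (field_local V i)) /\
  forall i t, a < t < b -> chart_dom (atlas i) (c t) ->
    derive1 (field_local V i) t
      + field_local V i t *m D i (atlas i (c t)) (derive1 (atlas i \o c) t) = 0.

(* Membership of the maximal atlas. *)
Definition admissible (phi : chart R n M) := forall i,
  smooth_on (overlap phi (atlas i)) (transition phi (atlas i)) /\
  smooth_on (overlap (atlas i) phi) (transition (atlas i) phi).

End Manifolds.

Section Maps.
Context {R : realType} {m n : nat} {M : manifold R m} {N : manifold R n}.
Implicit Types (F : M -> N) (p : M).

Definition smooth_map F := continuous F /\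
  forall i j, smooth_on
    (atlas i @` (chart_dom (atlas i) `&` F @^-1` chart_dom (atlas j)))
    (atlas j \o F \o chart_inv (atlas i)).

(* The matrix of dF_p : v |-> v *m tangent_map F p. *)
Definition tangent_map F p : 'M[R]_(m, n) :=
  'J (atlas (chart_at (F p)) \o F \o chart_inv (atlas (chart_at p)))
     (atlas (chart_at p) p).

Definition push F p (v : tangent p) : tangent (F p) := v *m tangent_map F p.

Definition pullback F p (a : cotangent (F p)) : cotangent p :=
  tangent_map F p *m a.

Definition affine_map (D : connection M) (D' : connection N) F :=
  smooth_map F /\
  forall (a b : R) (c : R -> M) (V : forall t, tangent (c t)),
    smooth_curve a b c -> parallel_along D a b V ->
    @parallel_along _ _ N D' a b (F \o c) (fun t => push F (V t)).

Definition kv_map (D : connection M) (h : bivector M)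
    (D' : connection N) (h' : bivector N) F :=
  affine_map D D' F /\
  forall (a b : one_form N) p,
    bilin (h p) (pullback (a (F p))) (pullback (b (F p)))
    = bilin (h' (F p)) (a (F p)) (b (F p)).

(* [N] is an embedded submanifold of [N'] via [f]: around every point there is *)
(* a chart of the target in which the image is the slice R^m x 0, and the      *)
(* first [m] coordinates of which form a chart of the source.                  *)
Definition submanifold_inclusion F :=
  [/\ (m <= n)%N, injective F &
   forall p, exists (phi : chart R n N) (psi : chart R m M),
    [/\ admissible phi /\ admissible psi, chart_dom phi (F p),
        chart_dom psi = F @^-1` chart_dom phi,
        (forall q, chart_dom psi q -> phi (F q) = psi q *m pid_mx m) &
        phi @` (chart_dom phi `&` range F)
          = chart_im phi `&` range (fun x : 'rV[R]_m => x *m pid_mx m)]].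

End Maps.

Section Submanifolds.
Context {R : realType} {n : nat} {M : manifold R n}.

Definition affine_submanifold (k : nat) (N : manifold R k)
    (DN : connection N) (D : connection M) (iota : N -> M) :=
  [/\ submanifold_inclusion iota, affine_structure DN & affine_map DN D iota].

Definition tangent_of (k : nat) (N : manifold R k) (iota : N -> M) (q : N)
  : set (tangent (iota q)) := range (fun v : tangent q => push iota v).
Arguments tangent_of {k N} iota q _.

Definition coisotropic_kv_submanifold (D : connection M) (h : bivector M)
    (S : set M) :=
  exists (k : nat) (N : manifold R k) (DN : connection N) (iota : N -> M),
  [/\ affine_submanifold DN D iota, range iota = S &
      forall q : N, sharp (h (iota q)) @` annihilator (tangent_of iota q)
                    `<=` tangent_of iota q].

End Submanifolds.

Definition graph (X Y : Type) (F : X -> Y) : set (X * Y) :=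
  [set z | z.2 = F z.1].

Section ProductCalculus.
Context {R : realType} {n1 n2 : nat}.
Implicit Types (U : set 'rV[R]_n1) (V : set 'rV[R]_n2).

Definition prod_rV U V : set 'rV[R]_(n1 + n2) :=
  [set x | U (lsubmx x) /\ V (rsubmx x)].

Definition row_map m1 m2 (f1 : 'rV[R]_n1 -> 'rV[R]_m1)
    (f2 : 'rV[R]_n2 -> 'rV[R]_m2) : 'rV[R]_(n1 + n2) -> 'rV[R]_(m1 + m2) :=
  fun x => row_mx (f1 (lsubmx x)) (f2 (rsubmx x)).

Definition block_map m1 m2 p1 p2 (f1 : 'rV[R]_n1 -> 'M[R]_(m1, p1))
    (f2 : 'rV[R]_n2 -> 'M[R]_(m2, p2))
    : 'rV[R]_(n1 + n2) -> 'M[R]_(m1 + m2, p1 + p2) :=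
  fun x => block_mx (f1 (lsubmx x)) 0 0 (f2 (rsubmx x)).

Lemma open_prod_rV U V : open U -> open V -> open (prod_rV U V).
Proof.
move=> o1 o2; apply: openI.
  by apply: open_comp => // x _; exact: continuous_lsubmx.
by apply: open_comp => // x _; exact: continuous_rsubmx.
Qed.

Section Block.
Context {m1 m2 p1 p2 : nat}.

Let up : 'M[R]_(m1 + m2, m1) := col_mx 1%:M 0.
Let dn : 'M[R]_(m1 + m2, m2) := col_mx 0 1%:M.
Let lf : 'M[R]_(p1, p1 + p2) := row_mx 1%:M 0.
Let rt : 'M[R]_(p2, p1 + p2) := row_mx 0 1%:M.

Let block1 : {linear 'M[R]_(m1, p1) -> 'M[R]_(m1 + m2, p1 + p2)} :=
  mulmxr lf \o mulmx up.
Let block2 : {linear 'M[R]_(m2, p2) -> 'M[R]_(m1 + m2, p1 + p2)} :=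
  mulmxr rt \o mulmx dn.

Let blockE a b : block_mx a 0 0 b = block1 a + block2 b.
Proof.
rewrite /= /up /dn /lf /rt !mul_col_mx !mul1mx !mul0mx.
by rewrite !mul_mx_row !mulmx1 !mulmx0 add_col_mx addr0 add0r.
Qed.

Let block_mapE (f1 : 'rV[R]_n1 -> 'M[R]_(m1, p1))
    (f2 : 'rV[R]_n2 -> 'M[R]_(m2, p2)) :
  block_map f1 f2 = (block1 \o f1 \o lsubmx) + (block2 \o f2 \o rsubmx).
Proof. by apply/funext => x; rewrite /block_map blockE. Qed.

Lemma smooth_on_block U V (f1 : 'rV[R]_n1 -> 'M[R]_(m1, p1))
    (f2 : 'rV[R]_n2 -> 'M[R]_(m2, p2)) :
  open U -> open V -> smooth_on U f1 -> smooth_on V f2 ->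
  smooth_on (prod_rV U V) (block_map f1 f2).
Proof.
move=> o1 o2 s1 s2 k; rewrite block_mapE.
have oU := open_prod_rV o1 o2.
apply: Ck_on_add => //.
  apply: (Ck_on_lin_comp (A := block1) (B := lsubmx) (U := U)) => //.
  - exact: continuous_linear_mx.
  - exact: continuous_linear_mx.
  - by move=> x [].
apply: (Ck_on_lin_comp (A := block2) (B := rsubmx) (U := V)) => //.
- exact: continuous_linear_mx.
- exact: continuous_linear_mx.
- by move=> x [].
Qed.

Lemma derive_block (f1 : 'rV[R]_n1 -> 'M[R]_(m1, p1))
    (f2 : 'rV[R]_n2 -> 'M[R]_(m2, p2)) x v :
  differentiable f1 (lsubmx x) -> differentiable f2 (rsubmx x) ->
  'D_v (block_map f1 f2) x
    = block_mx ('D_(lsubmx v) f1 (lsubmx x)) 0 0 ('D_(rsubmx v) f2 (rsubmx x)).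
Proof.
move=> d1 d2; rewrite block_mapE blockE.
have [d1' E1] := derive_lin_comp (A := block1) (B := lsubmx) v
  (@continuous_linear_mx _ _ _ _ _) (@continuous_linear_mx _ _ _ _ _) d1.
have [d2' E2] := derive_lin_comp (A := block2) (B := rsubmx) v
  (@continuous_linear_mx _ _ _ _ _) (@continuous_linear_mx _ _ _ _ _) d2.
by rewrite deriveD ?E1 ?E2 //; exact: diff_derivable.
Qed.

End Block.

Section Row.
Context {m1 m2 : nat}.

Let lf : 'M[R]_(m1, m1 + m2) := row_mx 1%:M 0.
Let rt : 'M[R]_(m2, m1 + m2) := row_mx 0 1%:M.

Let row_mapE (f1 : 'rV[R]_n1 -> 'rV[R]_m1) (f2 : 'rV[R]_n2 -> 'rV[R]_m2) :
  row_map f1 f2 = (mulmxr lf \o f1 \o lsubmx) + (mulmxr rt \o f2 \o rsubmx).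
Proof.
apply/funext => x; rewrite /row_map [RHS]/= /lf /rt fctE /= !mul_mx_row.
by rewrite !mulmx1 !mulmx0 add_row_mx addr0 add0r.
Qed.

Lemma smooth_on_row U V (f1 : 'rV[R]_n1 -> 'rV[R]_m1)
    (f2 : 'rV[R]_n2 -> 'rV[R]_m2) :
  open U -> open V -> smooth_on U f1 -> smooth_on V f2 ->
  smooth_on (prod_rV U V) (row_map f1 f2).
Proof.
move=> o1 o2 s1 s2 k; rewrite row_mapE.
have oU := open_prod_rV o1 o2.
apply: Ck_on_add => //.
  apply: (Ck_on_lin_comp (A := mulmxr lf) (B := lsubmx) (U := U)) => //.
  - exact: continuous_linear_mx.
  - exact: continuous_linear_mx.
  - by move=> x [].
apply: (Ck_on_lin_comp (A := mulmxr rt) (B := rsubmx) (U := V)) => //.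
- exact: continuous_linear_mx.
- exact: continuous_linear_mx.
- by move=> x [].
Qed.

Lemma jacobian_row (f1 : 'rV[R]_n1 -> 'rV[R]_m1)
    (f2 : 'rV[R]_n2 -> 'rV[R]_m2) x :
  differentiable f1 (lsubmx x) -> differentiable f2 (rsubmx x) ->
  'J (row_map f1 f2) x
    = block_mx ('J f1 (lsubmx x)) 0 0 ('J f2 (rsubmx x)).
Proof.
move=> d1 d2; apply/row_matrixP => i; rewrite !rowE row_mapE.
have [d1' E1] := derive_lin_comp (A := mulmxr lf) (B := lsubmx) (delta_mx 0 i)
  (@continuous_linear_mx _ _ _ _ _) (@continuous_linear_mx _ _ _ _ _) d1.
have [d2' E2] := derive_lin_comp (A := mulmxr rt) (B := rsubmx) (delta_mx 0 i)
  (@continuous_linear_mx _ _ _ _ _) (@continuous_linear_mx _ _ _ _ _) d2.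
rewrite -deriveEjacobian; last exact: differentiableD.
rewrite deriveD ?E1 ?E2; [|exact: diff_derivable|exact: diff_derivable].
rewrite !deriveEjacobian // /lf /rt /= !mul_mx_row !mulmx1 !mulmx0 add_row_mx.
by rewrite addr0 add0r -[in RHS](hsubmxK (delta_mx 0 i)) mul_row_block !mulmx0
  addr0 add0r.
Qed.

End Row.
End ProductCalculus.

Section Overlap.
Context {R : realType} {n : nat} {T : topologicalType}.

Lemma overlapE (phi psi : chart R n T) :
  overlap phi psi = chart_im phi `&` chart_inv phi @^-1` chart_dom psi.
Proof.
apply/seteqP; split => [x [p [dp dp'] <-]|x [[p dp <-]]] /=.
  by split; [exists p | rewrite chart_mapK].
by rewrite chart_mapK // => dp'; exists p.
Qed.

Lemma open_overlap (phi psi : chart R n T) : open (overlap phi psi).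
Proof.
rewrite overlapE openE => x [ix dx]; apply: filterI.
  by apply: open_nbhs_nbhs; split => //; exact: chart_im_open.
apply: (chart_inv_cont ix).
by apply: open_nbhs_nbhs; split => //; exact: chart_dom_open.
Qed.

End Overlap.

Lemma open_prod (T1 T2 : topologicalType) (A : set T1) (B : set T2) :
  open A -> open B -> open (A `*` B).
Proof.
move=> oA oB; apply: openI.
  by apply: open_comp => // x _; exact: cvg_fst.
by apply: open_comp => // x _; exact: cvg_snd.
Qed.

Section Product.
Context {R : realType} {n1 n2 : nat}.

Section ProductChart.
Context {T1 T2 : topologicalType} (phi : chart R n1 T1) (psi : chart R n2 T2).

Definition prod_dom : set (T1 * T2) := chart_dom phi `*` chart_dom psi.

Definition prod_map (z : T1 * T2) : 'rV[R]_(n1 + n2) :=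
  row_mx (phi z.1) (psi z.2).

Definition prod_inv (x : 'rV[R]_(n1 + n2)) : T1 * T2 :=
  (chart_inv phi (lsubmx x), chart_inv psi (rsubmx x)).

Lemma prod_imE : prod_map @` prod_dom = prod_rV (chart_im phi) (chart_im psi).
Proof.
apply/seteqP; split => [_ [[p q] [/= dp dq] <-]|x [[p dp ep] [q dq eq]]].
  by split; rewrite /= ?row_mxKl ?row_mxKr; [exists p|exists q].
by exists (p, q) => //; rewrite /prod_map /= ep eq hsubmxK.
Qed.

Lemma prod_dom_open : open prod_dom.
Proof. by apply: open_prod; exact: chart_dom_open. Qed.

Lemma prod_im_open : open (prod_map @` prod_dom).
Proof. by rewrite prod_imE; apply: open_prod_rV; exact: chart_im_open. Qed.

Lemma prod_mapK p : prod_dom p -> prod_inv (prod_map p) = p.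
Proof.
by case: p => p q [dp dq]; rewrite /prod_inv row_mxKl row_mxKr !chart_mapK.
Qed.

Lemma prod_map_cont p : prod_dom p -> {for p, continuous prod_map}.
Proof.
case: p => p q [/= dp dq].
have -> : prod_map = (fun z : T1 * T2 =>
    mulmxr (row_mx 1%:M 0) (phi z.1) + mulmxr (row_mx 0 1%:M) (psi z.2)).
  apply/funext => z; rewrite /prod_map /= !mul_mx_row.
  by rewrite !mulmx1 !mulmx0 add_row_mx addr0 add0r.
apply: continuousD.
  apply: (@continuous_comp _ _ _ (fun z : T1 * T2 => phi z.1)
    (mulmxr (row_mx 1%:M 0))).
    apply: (@continuous_comp _ _ _ fst phi); first exact: cvg_fst.
    exact: chart_map_cont.
  exact: continuous_linear_mx.
apply: (@continuous_comp _ _ _ (fun z : T1 * T2 => psi z.2)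
  (mulmxr (row_mx 0 1%:M))).
  apply: (@continuous_comp _ _ _ snd psi); first exact: cvg_snd.
  exact: chart_map_cont.
exact: continuous_linear_mx.
Qed.

Lemma prod_inv_cont x :
  (prod_map @` prod_dom) x -> {for x, continuous prod_inv}.
Proof.
rewrite prod_imE => -[ix iy].
have c1 : {for x, continuous (chart_inv phi \o lsubmx)}.
  by apply: continuous_comp; [exact: continuous_lsubmx|exact: chart_inv_cont].
have c2 : {for x, continuous (chart_inv psi \o rsubmx)}.
  by apply: continuous_comp; [exact: continuous_rsubmx|exact: chart_inv_cont].
exact: cvg_pair c1 c2.
Qed.

Definition prod_chart : chart R (n1 + n2) (T1 * T2)%type :=
  Chart prod_dom_open prod_im_open prod_mapK prod_map_cont prod_inv_cont.

End ProductChart.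

Lemma prod_overlapE (T1 T2 : topologicalType) (phi phi' : chart R n1 T1)
    (psi psi' : chart R n2 T2) :
  overlap (prod_chart phi psi) (prod_chart phi' psi')
    = prod_rV (overlap phi phi') (overlap psi psi').
Proof.
rewrite !overlapE [chart_im _]prod_imE.
by apply/seteqP; split => x /= [[? ?] [? ?]].
Qed.

Lemma prod_hausdorff (T1 T2 : topologicalType) :
  hausdorff_space T1 -> hausdorff_space T2 -> hausdorff_space (T1 * T2)%type.
Proof.
move=> h1 h2 [p1 p2] [q1 q2] clpq.
congr pair; [apply: h1|apply: h2] => A B pA qB.
  have [|//|[a b] [Aa Bb]] := clpq (A `*` setT) (B `*` setT).
  - by exists (A, setT) => //; split => //; exact: filterT.
  - by exists (B, setT) => //; split => //; exact: filterT.
  - by exists a; split; [case: Aa|case: Bb].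
have [|//|[a b] [Aa Bb]] := clpq (setT `*` A) (setT `*` B).
- by exists (setT, A) => //; split => //; exact: filterT.
- by exists (setT, B) => //; split => //; exact: filterT.
- by exists b; split; [case: Aa|case: Bb].
Qed.

Lemma prod_second_countable (T1 T2 : topologicalType) :
  @second_countable T1 -> @second_countable T2 ->
  @second_countable (T1 * T2)%type.
Proof.
move=> [B1 cB1 [wB1 bB1]] [B2 cB2 [wB2 bB2]].
exists ((fun C : set T1 * set T2 => C.1 `*` C.2) @` (B1 `*` B2)).
  by apply: sub_countable (card_image_le _ _) _; exact: countableX.
split => [_ [[C1 C2] [/= BC1 BC2] <-]|[x y] A [[A1 A2] [/= xA1 yA2] sA]].
  by apply: open_prod; [exact: wB1|exact: wB2].
have [C1 [BC1 C1x] sC1] := bB1 _ _ xA1.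
have [C2 [BC2 C2y] sC2] := bB2 _ _ yA2.
exists (C1 `*` C2); first by split => //; exists (C1, C2).
by move=> [a b] [/= /sC1 ? /sC2 ?]; apply: sA.
Qed.

Variables (M1 : manifold R n1) (M2 : manifold R n2).

Definition prod_atlas (i : chart_index M1 * chart_index M2) :=
  prod_chart (atlas i.1) (atlas i.2).

Definition prod_chart_at (p : M1 * M2) := (chart_at p.1, chart_at p.2).

Lemma mem_prod_chart_at p : chart_dom (prod_atlas (prod_chart_at p)) p.
Proof. by split; exact: mem_chart_at. Qed.

Lemma prod_transitionE i j : transition (prod_atlas i) (prod_atlas j)
  = row_map (transition (atlas i.1) (atlas j.1))
            (transition (atlas i.2) (atlas j.2)).
Proof. by []. Qed.

Lemma prod_atlas_compat i j :
  smooth_on (overlap (prod_atlas i) (prod_atlas j))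
            (transition (prod_atlas i) (prod_atlas j)).
Proof.
rewrite prod_overlapE prod_transitionE.
apply: smooth_on_row.
- exact: open_overlap.
- exact: open_overlap.
- exact: atlas_compat.
- exact: atlas_compat.
Qed.

Definition prod_manifold : manifold R (n1 + n2) :=
  Manifold mem_prod_chart_at prod_atlas_compat
    (prod_hausdorff (@manifold_hausdorff _ _ M1) (@manifold_hausdorff _ _ M2))
    (prod_second_countable (@manifold_second_countable _ _ M1)
                           (@manifold_second_countable _ _ M2)).

Lemma transition_differentiable n (M : manifold R n) (i j : chart_index M) x :
  overlap (atlas i) (atlas j) x ->
  differentiable (transition (atlas i) (atlas j)) x.
Proof. by move=> ox; have [+ _] := atlas_compat i j 1%N; apply. Qed.

Lemma prod_jacobianE (i j : chart_index prod_manifold) x :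
  overlap (atlas i) (atlas j) x ->
  'J (transition (atlas i) (atlas j)) x
    = block_map (jacobian (transition (atlas i.1) (atlas j.1)))
                (jacobian (transition (atlas i.2) (atlas j.2))) x.
Proof.
rewrite [overlap _ _]prod_overlapE => -[w1 w2].
by rewrite [transition _ _]prod_transitionE jacobian_row //;
  exact: transition_differentiable.
Qed.

Section ProductConnection.
Variables (D1 : connection M1) (D2 : connection M2).

Definition prod_omega (i : chart_index prod_manifold) (x u : 'rV[R]_(n1 + n2))
  : 'M[R]_(n1 + n2) :=
  block_mx (D1 i.1 (lsubmx x) (lsubmx u)) 0 0 (D2 i.2 (rsubmx x) (rsubmx u)).

Lemma prod_omega_linear (i : chart_index prod_manifold) x :
  chart_im (atlas i) x -> linear (prod_omega i x).
Proof.
rewrite [chart_im _]prod_imE => -[x1 x2] a u v.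
rewrite /prod_omega !linearP /= (omega_linear D1 x1) (omega_linear D2 x2).
by rewrite scale_block_mx add_block_mx !scaler0 !addr0.
Qed.

Lemma prod_omega_smooth (i : chart_index prod_manifold) u :
  smooth_on (chart_im (atlas i)) (prod_omega i ^~ u).
Proof.
rewrite [chart_im _]prod_imE.
apply: (smooth_on_block (f1 := D1 i.1 ^~ (lsubmx u))
                        (f2 := D2 i.2 ^~ (rsubmx u))).
- exact: chart_im_open.
- exact: chart_im_open.
- exact: omega_smooth.
- exact: omega_smooth.
Qed.

Lemma prod_omega_gauge (i j : chart_index prod_manifold) x u :
  overlap (atlas i) (atlas j) x ->
  let tau := transition (atlas i) (atlas j) in
  'D_u (jacobian tau) x + 'J tau x *m prod_omega j (tau x) (u *m 'J tau x)
    = prod_omega i x u *m 'J tau x.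
Proof.
move=> ox tau; have := ox; rewrite [overlap _ _]prod_overlapE => -[w1 w2].
have nJ : {near x, jacobian tau =1
    block_map (jacobian (transition (atlas i.1) (atlas j.1)))
              (jacobian (transition (atlas i.2) (atlas j.2)))}.
  have : nbhs x (overlap (atlas i) (atlas j)).
    by apply: open_nbhs_nbhs; split => //; exact: open_overlap.
  by apply: filterS => y; exact: prod_jacobianE.
have dJ n (M : manifold R n) (k l : chart_index M) y :
    overlap (atlas k) (atlas l) y ->
    differentiable (jacobian (transition (atlas k) (atlas l))) y.
  move=> oy; have [+ _] := smooth_on_jacobian (@open_overlap _ _ _ _ _)
    (atlas_compat k l) 1%N; exact.
rewrite (near_eq_derive _ nJ) derive_block; [|exact: dJ|exact: dJ].
rewrite !prod_jacobianE // /prod_omega /block_map.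
have uE a b : u *m block_mx a 0 0 b
    = row_mx (lsubmx u *m a) (rsubmx u *m b) :> 'rV[R]_(n1 + n2).
  by rewrite -{1}[u]hsubmxK mul_row_block !mulmx0 addr0 add0r.
rewrite uE !row_mxKl !row_mxKr.
rewrite !mulmx_block !mulmx0 !mul0mx !addr0 !add0r add_block_mx !addr0.
congr block_mx.
  by rewrite -(omega_gauge D1 _ w1).
by rewrite -(omega_gauge D2 _ w2).
Qed.

Definition prod_connection : connection prod_manifold :=
  Connection prod_omega_linear prod_omega_smooth prod_omega_gauge.

End ProductConnection.

Section ProductBivector.
Variables (h1 : bivector M1) (h2 : bivector M2).

Definition prod_bivector_at (p : prod_manifold) : 'M[R]_(n1 + n2) :=
  block_mx (h1 p.1) 0 0 (h2 p.2).

Lemma prod_bivector_sym p : (prod_bivector_at p)^T = prod_bivector_at p.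
Proof. by rewrite /prod_bivector_at tr_block_mx !bivector_sym !trmx0. Qed.

Lemma prod_bivector_smooth (i : chart_index prod_manifold) :
  smooth_on (chart_im (atlas i)) (fun x =>
    bivector_coord (chart_inv (atlas i) x) i
      (prod_bivector_at (chart_inv (atlas i) x))).
Proof.
have o1 := @chart_im_open _ _ _ (atlas i.1).
have o2 := @chart_im_open _ _ _ (atlas i.2).
rewrite [chart_im _]prod_imE.
apply: smooth_on_ext (smooth_on_block o1 o2
  (bivector_smooth h1 i.1) (bivector_smooth h2 i.2)).
  exact: open_prod_rV.
move=> x [[p1 d1 e1] [p2 d2 e2]].
have E1 : chart_inv (atlas i.1) (lsubmx x) = p1 by rewrite -e1 chart_mapK.
have E2 : chart_inv (atlas i.2) (rsubmx x) = p2 by rewrite -e2 chart_mapK.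
have -> : chart_inv (atlas i) x = (p1, p2).
  by rewrite -E1 -E2.
rewrite /block_map E1 E2 /bivector_coord /change.
rewrite prod_jacobianE; last first.
  by exists (p1, p2) => //; split => //; exact: mem_chart_at.
rewrite /block_map row_mxKl row_mxKr tr_block_mx !trmx0 /prod_bivector_at.
by rewrite !mulmx_block ?mulmx0 ?mul0mx ?addr0 ?add0r ?mulmx0 ?mul0mx ?addr0.
Qed.

Definition prod_bivector : bivector prod_manifold :=
  Bivector prod_bivector_sym prod_bivector_smooth.

End ProductBivector.
End Product.

Section OppBivector.
Context {R : realType} {n : nat} {M : manifold R n} (h : bivector M).

Lemma opp_bivector_sym (p : M) : (- h p)^T = - h p.
Proof. by rewrite linearN /= bivector_sym. Qed.

Lemma opp_bivector_smooth (i : chart_index M) :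
  smooth_on (chart_im (atlas i)) (fun x =>
    bivector_coord (chart_inv (atlas i) x) i (- h (chart_inv (atlas i) x))).
Proof.
move=> k; have oi := @chart_im_open _ _ _ (atlas i).
apply: Ck_on_ext (Ck_on_lin_comp (A := -%R) (B := idfun) _ _ oi _
  (bivector_smooth h i k)) => //.
- by move=> x _; rewrite /bivector_coord /= mulmxN mulNmx.
- exact: continuous_linear_mx.
- exact: continuous_linear_mx.
Qed.

Definition opp_bivector : bivector M :=
  Bivector opp_bivector_sym opp_bivector_smooth.

End OppBivector.

(* Main.v *)
(* Vectors are rows, and T denotes the matrix of dF at a point p, so that the   *)
(* graph of F has tangent space {(v, v T)}.  The annihilator of this space is   *)
(* {(- T a, a)}, and its image under the bivector h1 (+) (- h2) lies in the     *)
(* tangent space iff T^T h1 T = h2, i.e. iff F^* preserves the bivectors on     *)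
(* covectors at p; bump functions extend covectors to global one-forms.         *)
(* A field along a curve in the product is parallel iff both components are,    *)
(* so if F is affine then so is p |-> (p, F p).  Conversely, suppose that the   *)
(* graph is an affine submanifold with inclusion iota : N -> M1 x M2.  By the   *)
(* slice charts, p |-> (p, F p) factors through iota, which gives a smooth      *)
(* section s of g = pr1 o iota.  Given V parallel along c in M1 and a time t0,  *)
(* solve a linear ODE to get W parallel in N along s o c, near t0, with         *)
(* dg (W t0) = V t0.  Then X = dg W and dF X are parallel and X agrees with V   *)
(* to first order at t0, so dF V satisfies the parallel transport equation at   *)
(* t0.                                                                          *)
Require Import Defs.
From HB Require Import structures.
From mathcomp Require Import all_boot all_order all_algebra.
From mathcomp Require Import all_classical all_reals.
From mathcomp Require Import set_interval topology normedtype landau derive.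
From mathcomp Require Import sesquilinear ring lra.
From mathcomp Require Import sequences realfun exp measure lebesgue_measure.
From mathcomp Require Import lebesgue_integral ftc.

Set Implicit Arguments.
Unset Strict Implicit.
Unset Printing Implicit Defensive.

Import Order.TTheory GRing.Theory Num.Theory.
Import numFieldNormedType.Exports.

Local Open Scope classical_set_scope.
Local Open Scope ring_scope.

(** * Calculus of C^k maps *)


(** Each condition has a tensorial half and an affine half, and the halves are compared separately.

    Tensorial half. At a point everything is linear algebra on the span of the rows of
    [row_mx G (G *m T)], settled by [graph_coisotropicP]. A K-V map is tested on global one-forms,
    the matrix identity on covectors at a point; [preserves_bivectorP] bridges the two, since by
    [one_form_through] every covector is a value of a global form.

    Affine half. Parallel fields in a product are pairs of parallel fields ([parallel_along_prod]).
    If [F] is affine, the graph is [M1] itself with its connection, embedded by [graph_map]; a shear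
    in product charts supplies the slice charts ([graph_map_slice]). Conversely the graph is the
    image of some [iota] from a manifold [N] whose dimension is not prescribed. Since [iota] is an
    embedding, the set-theoretic section [s] of [g], the first component of [iota], is smooth
    ([smooth_map_factor]), and the differential of [s] is a one-sided inverse of that of [g]. A
    parallel field [V] on [M1] need not be lifted globally to [N]: the transport equation at [t0]
    sees only the value and first derivative there. A local parallel field of [N] with the right
    value at [t0], given by [exists_parallel_field], therefore suffices in [affine_map_of_graph].
    This is what requires solving linear differential equations. *)

Section ScaleBilinear.
Variables (R : realType) (W : normedModType R).

(** Packs scalar multiplication as a bilinear map, so that [Ck_on_scale] becomes an instance of
    [Ck_on_bilinear]. *)
Lemma scale_is_bilinear : bilinear_for
  (GRing.Scale.Law.clone _ _ *:%R _) (GRing.Scale.Law.clone _ _ *:%R _)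
  (@GRing.scale R W : R^o -> W -> W).
Proof.
split=> [w|a] b u v /=; first by rewrite scalerDl scalerA.
by rewrite scalerDr !scalerA mulrC.
Qed.

HB.instance Definition _ := bilinear_isBilinear.Build R R^o W W _ _
  (@GRing.scale R W) scale_is_bilinear.

End ScaleBilinear.

Section CkCalculus.
Variable R : realType.
Implicit Types V W X : normedModType R.

Lemma Ck_onS V W k (U U' : set V) (f : V -> W) :
  U' `<=` U -> Ck_on k U f -> Ck_on k U' f.
Proof.
move=> sU; elim: k f => [|k IH] f /=; first by move=> cf x /sU; exact: cf.
by move=> [df Cf]; split => [x /sU|v]; [exact: df|exact: IH].
Qed.

Lemma smooth_onS V W (U U' : set V) (f : V -> W) :
  U' `<=` U -> smooth_on U f -> smooth_on U' f.
Proof. by move=> sU sf k; exact: Ck_onS (sf k). Qed.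

(** Every clause of [Ck_on] is a condition at single points of the set, with derivatives taken in
    the whole space; hence the sets [U'] can be arbitrary. *)
Lemma Ck_on_local V W k (U : set V) (f : V -> W) :
  (forall x, U x -> exists2 U', U' x & Ck_on k U' f) -> Ck_on k U f.
Proof.
elim: k f => [|k IH] f loc /=.
  by move=> x Ux; have [U' U'x] := loc x Ux; exact.
split => [x Ux|v]; first by have [U' U'x [+ _]] := loc x Ux; exact.
by apply: IH => x Ux; have [U' U'x [_ Cf]] := loc x Ux; exists U'; last exact: Cf.
Qed.

Lemma smooth_on_local V W (U : set V) (f : V -> W) :
  (forall x, U x -> exists2 U', U' x & smooth_on U' f) -> smooth_on U f.
Proof.
by move=> loc k; apply: Ck_on_local => x /loc [U' U'x sf]; exists U'; last exact: sf.
Qed.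

Lemma smooth_on_differentiable V W (U : set V) (f : V -> W) x :
  smooth_on U f -> U x -> differentiable f x.
Proof. by move=> sf; have [+ _] := sf 1%N; apply. Qed.

Lemma smooth_on_continuous V W (U : set V) (f : V -> W) x :
  smooth_on U f -> U x -> {for x, continuous f}.
Proof. by move=> /(_ 0%N); apply. Qed.

Lemma smooth_on_derive V W (U : set V) (f : V -> W) v :
  smooth_on U f -> smooth_on U ('D_v f).
Proof. by move=> sf k; have [_] := sf k.+1; exact. Qed.

Lemma Ck_on_cst V W k (U : set V) (w : W) : open U -> Ck_on k U (cst w).
Proof.
move=> oU; case: k => [|k] /=; first by move=> x _; exact: cvg_cst.
split => [x _|v]; first exact: differentiable_cst.
by apply: Ck_on_ext (Ck_on_0 _ _ oU) => // x _; rewrite derive_cst.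
Qed.

Lemma Ck_on_linear V W k (U : set V) (A : {linear V -> W}) :
  continuous A -> open U -> Ck_on k U A.
Proof.
move=> cA oU; case: k => [|k] /=; first by move=> x _; exact: cA.
have dA x : differentiable A x by exact: linear_differentiable.
split => // v; apply: Ck_on_ext (Ck_on_cst k (A v) oU) => // x _.
by rewrite deriveE // diff_lin.
Qed.

Lemma Ck_on_lin V W X k (U : set V) (A : {linear W -> X}) (f : V -> W) :
  continuous A -> open U -> Ck_on k U f -> Ck_on k U (A \o f).
Proof.
move=> cA oU Cf; apply: (Ck_on_lin_comp (B := idfun) cA _ oU _ Cf) => //.
by move=> x; exact: cvg_id.
Qed.

Lemma smooth_on_lin V W X (U : set V) (A : {linear W -> X}) (f : V -> W) :
  continuous A -> open U -> smooth_on U f -> smooth_on U (A \o f).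
Proof. by move=> cA oU sf k; exact: Ck_on_lin (sf k). Qed.

Lemma smooth_on_add V W (U : set V) (f g : V -> W) :
  open U -> smooth_on U f -> smooth_on U g -> smooth_on U (f + g).
Proof. by move=> oU sf sg k; exact: Ck_on_add (sf k) (sg k). Qed.

Lemma differentiable_bilinear V W1 W2 W (B : {bilinear W1 -> W2 -> W})
    (f : V -> W1) (g : V -> W2) x :
  continuous (fun p => B p.1 p.2) -> differentiable f x ->
  differentiable g x -> differentiable (fun y => B (f y) (g y)) x.
Proof.
move=> cB df dg.
apply: (@differentiable_comp _ _ _ _ (fun y => (f y, g y)) (fun p => B p.1 p.2)).
  exact: differentiable_pair.
exact: differentiable_bilin.
Qed.

Lemma derive_bilinear V W1 W2 W (B : {bilinear W1 -> W2 -> W})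
    (f : V -> W1) (g : V -> W2) x v :
  continuous (fun p => B p.1 p.2) -> differentiable f x ->
  differentiable g x ->
  'D_v (fun y => B (f y) (g y)) x = B (f x) ('D_v g x) + B ('D_v f x) (g x).
Proof.
move=> cB df dg; rewrite !deriveE //; last exact: differentiable_bilinear.
rewrite (@diff_comp _ _ _ _ (fun y => (f y, g y)) (fun p => B p.1 p.2)).
- by rewrite /= diff_bilin // diff_pair.
- exact: differentiable_pair.
- exact: differentiable_bilin.
Qed.

Lemma Ck_onW V W k (U : set V) (f : V -> W) : Ck_on k.+1 U f -> Ck_on k U f.
Proof.
elim: k f => [|k IH] f [df Cf] /=; last by split=> // v; exact: IH.
by move=> x Ux; exact/differentiable_continuous/df.
Qed.

(** By the product rule the derivative is a sum of two expressions of the same shape, in which one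
    argument is differentiated and the other only loses an order of regularity. *)
Lemma Ck_on_bilinear V W1 W2 W k (B : {bilinear W1 -> W2 -> W}) (U : set V)
    (f : V -> W1) (g : V -> W2) :
  continuous (fun p => B p.1 p.2) -> open U -> Ck_on k U f -> Ck_on k U g ->
  Ck_on k U (fun y => B (f y) (g y)).
Proof.
move=> cB oU; elim: k f g => [|k IH] f g.
  move=> cf cg x Ux.
  apply: (@continuous_comp _ _ _ (fun y => (f y, g y)) (fun p => B p.1 p.2)).
    exact: cvg_pair (cf x Ux) (cg x Ux).
  exact: cB.
move=> Cf Cg; have [df Cdf] := Cf; have [dg Cdg] := Cg.
split=> [x Ux|v].
  by apply: differentiable_bilinear; [|exact: df|exact: dg].
apply: Ck_on_ext (Ck_on_add oU (IH _ _ (Ck_onW Cf) (Cdg v))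
  (IH _ _ (Cdf v) (Ck_onW Cg))) => // x Ux.
by rewrite derive_bilinear //; [exact: df|exact: dg].
Qed.

Lemma Ck_on_scale V W k (U : set V) (a : V -> R^o) (f : V -> W) :
  open U -> Ck_on k U a -> Ck_on k U f -> Ck_on k U (fun x => a x *: f x).
Proof. by apply: Ck_on_bilinear; exact: scale_continuous. Qed.

Lemma mulmx_continuous m n p :
  continuous (fun z : 'M[R]_(m, n) * 'M[R]_(n, p) => z.1 *m z.2).
Proof.
have -> : (fun z : 'M[R]_(m, n) * 'M[R]_(n, p) => z.1 *m z.2) = (fun z =>
    \sum_i \sum_j z.1 i j *: (mulmx (delta_mx i j) z.2)).
  apply/funext => z; rewrite {1}[z.1]matrix_sum_delta mulmx_suml.
  apply: eq_bigr => i _; rewrite mulmx_suml; apply: eq_bigr => j _.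
  by rewrite scalemxAl.
apply: continuous_big => [|i _]; first exact: add_continuous.
apply: continuous_big => [|j _]; first exact: add_continuous.
move=> z; apply: (@cvgZ _ _ _ (nbhs z) _ (fun z => z.1 i j)).
  apply: (@continuous_comp _ _ _ fst (fun M : 'M[R]_(m, n) => M i j)).
    exact: cvg_fst.
  exact: coord_continuous.
apply: (@continuous_comp _ _ _ snd
  (fun N : 'M[R]_(n, p) => (delta_mx i j : 'M[R]_(m, n)) *m N)).
  exact: cvg_snd.
exact: continuous_linear_mx.
Qed.

Lemma derive_mulmx V m n p (f : V -> 'M[R]_(m, n)) (g : V -> 'M[R]_(n, p)) x v :
  differentiable f x -> differentiable g x ->
  'D_v (fun y => f y *m g y) x = f x *m 'D_v g x + 'D_v f x *m g x.
Proof. by apply: derive_bilinear; exact: mulmx_continuous. Qed.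

Lemma Ck_on_mulmx V m n p k (U : set V) (f : V -> 'M[R]_(m, n))
    (g : V -> 'M[R]_(n, p)) :
  open U -> Ck_on k U f -> Ck_on k U g -> Ck_on k U (fun y => f y *m g y).
Proof. by apply: Ck_on_bilinear; exact: mulmx_continuous. Qed.

Lemma smooth_on_mulmx V m n p (U : set V) (f : V -> 'M[R]_(m, n))
    (g : V -> 'M[R]_(n, p)) :
  open U -> smooth_on U f -> smooth_on U g ->
  smooth_on U (fun y => f y *m g y).
Proof. by move=> oU sf sg k; exact: Ck_on_mulmx (sf k) (sg k). Qed.

Lemma Ck_on_entry V m n k (U : set V) (f : V -> 'M[R]_(m, n)) i j :
  open U -> Ck_on k U f -> Ck_on k U (fun x => f x i j : R^o).
Proof.
have lin : linear (fun M : 'M[R]_(m, n) => M i j : R^o).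
  by move=> a M N; rewrite !mxE.
pose c : {linear 'M[R]_(m, n) -> R^o} :=
  HB.pack (fun M : 'M[R]_(m, n) => M i j : R^o)
    (GRing.isLinear.Build _ _ _ _ _ lin).
by apply: (Ck_on_lin (A := c)); exact: coord_continuous.
Qed.

Lemma derive_comp V n W (f : V -> 'rV[R]_n) (g : 'rV[R]_n -> W) x v :
  differentiable f x -> differentiable g (f x) ->
  'D_v (g \o f) x = 'D_('D_v f x) g (f x).
Proof.
move=> df dg; rewrite deriveE; last exact: differentiable_comp.
by rewrite diff_comp //= deriveE // deriveE.
Qed.

Lemma derive_coord n W (g : 'rV[R]_n -> W) x u :
  differentiable g x ->
  'D_u g x = \sum_i u 0 i *: 'D_(delta_mx 0 i) g x.
Proof.
move=> dg; rewrite deriveE // {1}[u]row_sum_delta linear_sum.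
by apply: eq_bigr => i _; rewrite linearZ deriveE.
Qed.

Lemma Ck_on_comp V n W k (U : set V) (U' : set 'rV[R]_n)
    (f : V -> 'rV[R]_n) (g : 'rV[R]_n -> W) :
  open U -> (forall x, U x -> U' (f x)) ->
  Ck_on k U f -> Ck_on k U' g -> Ck_on k U (g \o f).
Proof.
move=> oU UU'; elim: k g => [|k IH] g.
  move=> cf cg x Ux; apply: continuous_comp; first exact: cf.
  exact/cg/UU'.
move=> Cf Cg; have [df Cdf] := Cf; have [dg Cdg] := Cg.
split=> [x Ux|v].
  by apply: differentiable_comp; [exact: df|exact/dg/UU'].
(* The chain rule differentiates [g] in a direction that varies with [x], whereas [Ck_on] speaks of
   fixed directions. Expanding the direction in the standard basis gives scalar multiples of partial
   derivatives of [g], to which the induction hypothesis applies. *)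
have Cs : Ck_on k U (\sum_i (fun x =>
    ('D_v f x 0 i : R^o) *: 'D_(delta_mx 0 i) g (f x))).
  elim/big_ind: _ => [|a b Ca Cb|i _]; first exact: Ck_on_0.
    exact: Ck_on_add.
  apply: Ck_on_scale => //; last exact: (IH _ (Ck_onW Cf) (Cdg _)).
  exact: (Ck_on_entry _ _ oU (Cdf v)).
apply: Ck_on_ext Cs => // x Ux.
rewrite (derive_comp _ (df _ Ux) (dg _ (UU' _ Ux))).
by rewrite fct_sumE (derive_coord _ (dg _ (UU' _ Ux))).
Qed.

Lemma smooth_on_comp V n W (U : set V) (U' : set 'rV[R]_n)
    (f : V -> 'rV[R]_n) (g : 'rV[R]_n -> W) :
  open U -> (forall x, U x -> U' (f x)) ->
  smooth_on U f -> smooth_on U' g -> smooth_on U (g \o f).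
Proof. by move=> oU UU' sf sg k; exact: Ck_on_comp UU' (sf k) (sg k). Qed.

End CkCalculus.

(** * Linear differential equations *)


Section Antiderivative.
Variable R : realType.

Lemma derivable_antiderivative (f : R -> R) (a b : R) : continuous f ->
  exists F : R -> R, forall x, x \in `]a, b[ -> is_derive x 1 F (f x).
Proof.
move=> cf; pose F x := (\int[lebesgue_measure]_(t in [set` `[a, x]]) (f t))%R.
exists F => x; rewrite in_itv /= => /andP[ax xb].
have fi : lebesgue_measure.-integrable [set` `[a, b]] (EFin \o f).
  apply: continuous_compact_integrable; first exact: segment_compact.
  exact: continuous_subspaceT.
have [] := @continuous_FTC1 R f (BLeft a) x b xb fi _ (cf x); first by move: ax.
by move=> dF FE; apply: DeriveDef; [exact: dF|rewrite -FE derive1E].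
Qed.

Lemma rV_norm_le n (v : 'rV[R]_n) K :
  0 <= K -> (forall i, `|v 0 i| <= K) -> `|v| <= K.
Proof.
move=> K0 vK; rewrite [leLHS]/Num.Def.normr /= mx_normrE.
by apply: bigmax_le => // -[i j] _; rewrite ord1.
Qed.

Lemma rV_norm_ge n (v : 'rV[R]_n) i : `|v 0 i| <= `|v|.
Proof.
rewrite [leRHS]/Num.Def.normr /= mx_normrE.
exact: (le_bigmax _ _ (0, i)).
Qed.

(* The retraction onto [t0 - d, t0 + d]: composing with it makes local data     *)
(* globally defined.                                                            *)
Definition clamp (t0 d t : R) := Num.max (t0 - d) (Num.min (t0 + d) t).

Lemma clamp_itv t0 d t : 0 < d -> `|clamp t0 d t - t0| <= d.
Proof.
move=> d0; rewrite /clamp ler_distl.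
have dd : t0 - d <= t0 + d by rewrite lerD2l (le_trans _ (ltW d0)) // oppr_le0 ltW.
by rewrite le_max lexx /= ge_max dd ge_min lexx.
Qed.

Lemma clamp_id t0 d t : `|t - t0| <= d -> clamp t0 d t = t.
Proof.
rewrite ler_distl /clamp => /andP[l r].
by rewrite (min_idPr r) (max_idPr l).
Qed.

Lemma clamp_lipschitz t0 d s t : `|clamp t0 d s - clamp t0 d t| <= `|s - t|.
Proof.
have st := ler_norm (s - t); have ts := ler_norm (t - s).
rewrite distrC in ts; rewrite /clamp !maxEle !minEle ler_norml.
by case: (leP (t0 + d) s) => ?; case: (leP (t0 + d) t) => ?;
  case: (leP (t0 - d) (t0 + d)) => ?; case: (leP (t0 - d) s) => ?;
  case: (leP (t0 - d) t) => ?; apply/andP; split; lra.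
Qed.

(** With [e k] the tail of the geometric series, the intervals of centre [u k] and radius [e k] are
    nested; the supremum of their left endpoints lies in all of them. *)
Lemma limit_of_geometric_increments (u : nat -> R) M :
  (forall k, `|u k.+1 - u k| <= M / 2 ^+ k) ->
  exists l, forall k, `|l - u k| <= 2 * M / 2 ^+ k.
Proof.
move=> uM; pose e k := 2 * M / 2 ^+ k.
have eS k : e k.+1 = M / 2 ^+ k.
  by rewrite /e exprS -mulf_div divff ?mul1r // pnatr_eq0.
have eD k : e k = M / 2 ^+ k + M / 2 ^+ k by rewrite /e -mulrA mulr_natl mulr2n.
have e0 k : 0 <= e k.
  by rewrite eD addr_ge0 //; exact: le_trans (normr_ge0 _) (uM k).
have incr j k : u j - e j <= u (j + k)%N - e (j + k)%N.
  elim: k => [|k IH]; first by rewrite addn0.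
  apply: le_trans IH _; rewrite addnS eS eD.
  by have := uM (j + k)%N; rewrite ler_norml => /andP[? ?]; lra.
have decr j k : u (j + k)%N + e (j + k)%N <= u j + e j.
  elim: k => [|k IH]; first by rewrite addn0.
  apply: le_trans IH; rewrite addnS eS eD.
  by have := uM (j + k)%N; rewrite ler_norml => /andP[? ?]; lra.
have ub k : ubound (range (fun j => u j - e j)) (u k + e k).
  move=> _ [j _ <-]; apply: le_trans (incr j k) _; apply: le_trans (decr k j).
  by rewrite addnC lerD2l ge0_cp.
have hs : has_sup (range (fun j => u j - e j)).
  by split; [exists (u 0%N - e 0%N), 0%N | exists (u 0%N + e 0%N)].
exists (sup (range (fun j => u j - e j))) => k.
rewrite ler_distl; apply/andP; split; last by apply: ge_sup => //; case: hs.
by apply: ub_le_sup; [case: hs|exists k].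
Qed.

Lemma lipschitz_continuous (W : normedModType R) (f : R -> W) K :
  (forall s t, `|f s - f t| <= K * `|s - t|) -> continuous f.
Proof.
move=> fK x; apply/cvgrPdist_lt => e e0.
have K0 : 0 < `|K| + 1 by rewrite ltr_wpDl.
near=> y; apply: le_lt_trans (fK _ _) _.
apply: (@le_lt_trans _ _ ((`|K| + 1) * `|x - y|)).
  by rewrite ler_wpM2r // (le_trans (ler_norm K)) // lerDl.
rewrite mulrC -ltr_pdivlMr //.
by near: y; apply: cvgr_dist_lt; rewrite ?divr_gt0 //; exact: cvg_id.
Unshelve. all: by end_near. Qed.

Lemma clamp_continuous t0 d : continuous (clamp t0 d).
Proof.
apply: (@lipschitz_continuous _ _ 1) => s t.
by rewrite mul1r clamp_lipschitz.
Qed.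

(** The norm on rows is the maximum norm, so the scalar mean value theorem can be applied to each
    coordinate with the same constant. *)
Lemma derivative_lipschitz n (F f : R -> 'rV[R]_n) (t0 d K : R) :
  0 < d -> continuous F ->
  (forall t, `|t - t0| < d -> is_derive t 1 F (f t)) ->
  (forall t, `|t - t0| <= d -> `|f t| <= K) ->
  forall s t, `|s - t0| <= d -> `|t - t0| <= d -> `|F s - F t| <= K * `|s - t|.
Proof.
move=> d0 cF dF fK s t.
have K0 : 0 <= K.
  by apply: le_trans (fK t0 _); rewrite ?normr_ge0 // subrr normr0 ltW.
wlog st : s t / s <= t => [H cs ct|].
  case: (leP s t) => [st|/ltW ts]; first exact: H.
  by rewrite distrC (distrC s); exact: H.
rewrite !ler_distl => /andP[? ?] /andP[? ?].
apply: rV_norm_le => [|i]; first by rewrite mulr_ge0.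
have dFi x : x \in `]s, t[ -> is_derive x 1 (fun y => F y 0 i : R) (f x 0 i).
  rewrite in_itv /= => /andP[? ?].
  have [] : is_derive x 1 F (f x).
    by apply: dF; rewrite ltr_distl; apply/andP; split; lra.
  move=> dFx <-; apply: DeriveDef; first by have /derivable_mxP := dFx; exact.
  by rewrite derive_mx // mxE.
have cFi : {within `[s, t], continuous (fun y => F y 0 i : R)}.
  apply: continuous_subspaceT => x.
  by apply: (@continuous_comp _ _ _ F (fun M : 'rV[R]_n => M 0 i));
    [exact: cF|exact: coord_continuous].
have [c + cE] := MVT_segment st dFi cFi.
rewrite !mxE distrC cE in_itv /= => /andP[? ?].
rewrite normrM (distrC s) ler_wpM2r //.
apply: le_trans (rV_norm_ge _ _) (fK _ _).
by rewrite ler_distl; apply/andP; split; lra.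
Qed.

Lemma antiderivative n (f : R -> 'rV[R]_n) (t0 d : R) :
  0 < d -> continuous f ->
  exists F : R -> 'rV[R]_n, [/\ F t0 = 0, continuous F &
    forall t, `|t - t0| < d -> is_derive t 1 F (f t)].
Proof.
move=> d0 cf.
have cfi i : continuous (fun t => f t 0 i : R).
  by move=> t; apply: (@continuous_comp _ _ _ f (fun M : 'rV[R]_n => M 0 i));
    [exact: cf|exact: coord_continuous].
(* The margin of 1 puts the closed interval of radius [d] inside the open one where the derivative
   exists, so that [F i] composed with [clamp] is continuous everywhere. *)
have /choice [F dF] i :=
  derivable_antiderivative (t0 - d - 1) (t0 + d + 1) (cfi i).
have inI t : `|t - t0| <= d -> t \in `]t0 - d - 1, t0 + d + 1[.
  by rewrite ler_distl in_itv /= => /andP[? ?]; apply/andP; split; lra.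
have cl0 : clamp t0 d t0 = t0 by rewrite clamp_id // subrr normr0 ltW.
pose G t := \row_i (F i (clamp t0 d t) - F i t0).
exists G; split.
- by apply/rowP => i; rewrite !mxE cl0 subrr.
- move=> t; apply/cvgrPdist_le => e e0; near=> x.
  apply: rV_norm_le => [|i]; first exact: ltW.
  rewrite !mxE opprB addrA addrNK; move: i; near: x; apply: filter_forall => i.
  have cFc : {for t, continuous (F i \o clamp t0 d)}.
    apply: continuous_comp; first exact: clamp_continuous.
    apply/differentiable_continuous/derivable1_diffP.
    by have [] := dF i _ (inI _ (clamp_itv t0 t d0)).
  by have /cvgrPdist_le /(_ _ e0) := cFc.
- move=> t td.
  have nearc i : {near t, F i - cst (F i t0) =1 (fun x => G x 0 i)}.
    have : nbhs t [set x | `|x - t0| < d].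
      apply: open_nbhs_nbhs; split => //.
      have -> : [set x | `|x - t0| < d] = ball t0 d.
        by apply/seteqP; split => x; rewrite -ball_normE /= distrC.
      exact: ball_open.
    by apply: filterS => x /= xd; rewrite mxE clamp_id // ltW.
  have dGi i : is_derive t 1 (fun x => G x 0 i) (f t 0 i).
    apply: near_eq_is_derive (nearc i) _.
    rewrite -[f t 0 i]subr0; apply: is_deriveB.
    exact/dF/inI/ltW.
  have dG : derivable G t 1.
    by apply/derivable_mxP => i j; rewrite ord1; case: (dGi j).
  apply: DeriveDef => //; rewrite derive_mx //; apply/rowP => i; rewrite mxE.
  by case: (dGi i).
Unshelve. all: by end_near. Qed.

Lemma le_of_geometric_error (a b M : R) :
  (forall k : nat, a <= b + M / 2 ^+ k) -> a <= b.
Proof.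
move=> ab; have : (fun k => b + M / 2 ^+ k) @ \oo --> b + M * 0.
  apply: cvgD; first exact: cvg_cst.
  apply: cvgM; first exact: cvg_cst.
  have -> : (fun k : nat => (2 ^+ k : R)^-1) = geometric 1 (2^-1).
    by apply/funext => k; rewrite /= mul1r exprVn.
  by apply: cvg_geometric; rewrite ger0_norm ?invr_ge0 // invf_lt1 // ltr1n.
rewrite mulr0 addr0 => cv.
by apply: (cvgr_to_ge cv); exact: nearW.
Qed.

End Antiderivative.


Section LinearODE.
Variable R : realType.

(** Picard iteration for W' = W A: the iterates converge geometrically to some [U], and [w + P U] is
    a solution, where [P f] is the antiderivative of [f *m A1] that vanishes at [t0]. *)
Lemma linear_ode n (A : R -> 'M[R]_n) (t0 e : R) (w : 'rV[R]_n) :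
  0 < e -> (forall t, `|t - t0| < e -> {for t, continuous A}) ->
  exists d : R, [/\ 0 < d, d <= e & exists W : R -> 'rV[R]_n,
    W t0 = w /\ forall t, `|t - t0| < d -> is_derive t 1 W (W t *m A t)].
Proof.
move=> e0 cA.
have [k k0 kP] := bilinear_schwarz (f := mulmx) (@mulmx_continuous R 1 n n).
have At0 : {for t0, continuous A} by apply: cA; rewrite subrr normr0.
have [e1 /= e10 e1P] : exists2 e1, 0 < e1 & forall t, `|t - t0| <= e1 ->
    `|t - t0| < e /\ `|A t| <= `|A t0| + 1.
  have /cvgrPdist_le /(_ _ ltr01) /nbhs_ballP[r /= r0 rP] := At0.
  exists (Num.min (r / 2) (e / 2)) => [|t]; first by rewrite lt_min !divr_gt0.
  rewrite le_min => /andP[tr te]; split.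
    by rewrite (le_lt_trans te) // ltr_pdivrMr // ltr_pMr // ltr1n.
  rewrite -[A t](subrK (A t0)) addrC (le_trans (ler_normD _ _)) // lerD2l.
  rewrite distrC; apply: rP; rewrite -ball_normE /= distrC.
  by rewrite (le_lt_trans tr) // ltr_pdivrMr // ltr_pMr // ltr1n.
have e1e : e1 <= e.
  have := e1P (t0 + e1); rewrite addrAC subrr add0r gtr0_norm // lexx.
  by case=> // /ltW.
pose A1 t := A (clamp t0 e1 t); pose C := `|A t0| + 1; pose K := k * C.
have C0 : 0 < C by rewrite ltr_wpDl.
have K0 : 0 < K by rewrite mulr_gt0.
have A1C t : `|A1 t| <= C by have [] := e1P _ (clamp_itv t0 t e10).
have cA1 : continuous A1.
  move=> t; apply: continuous_comp; first exact: clamp_continuous.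
  by apply: cA; have [] := e1P _ (clamp_itv t0 t e10).
have mulK (v : 'rV[R]_n) t : `|v *m A1 t| <= K * `|v|.
  apply: le_trans (kP _ _) _; rewrite /K mulrAC ler_wpM2r //.
  by rewrite ler_wpM2l // ltW.
pose d := Num.min e1 (2 * K)^-1.
have d0 : 0 < d by rewrite lt_min e10 invr_gt0 mulr_gt0.
have Kd : K * d <= 2^-1.
  have : d <= (2 * K)^-1 by rewrite ge_min lexx orbT.
  by rewrite -ler_pdivlMl // -invfM [K * 2]mulrC.
have tA1 t : `|t - t0| < d -> A1 t = A t.
  move=> /ltW td; rewrite /A1 clamp_id // (le_trans td) //.
  by rewrite ge_min lexx.
have cfA (f : R -> 'rV[R]_n) : continuous f -> continuous (fun t => f t *m A1 t).
  move=> cf t; apply: (@continuous_comp _ _ _ (fun t => (f t, A1 t))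
    (fun z : 'rV[R]_n * 'M[R]_n => z.1 *m z.2)).
    exact: cvg_pair (cf t) (cA1 t).
  exact: mulmx_continuous.
(* [P] is made a total operator on functions; on discontinuous [f] it takes the default value 0 and
   nothing is claimed. *)
have /choice [P PE] (f : R -> 'rV[R]_n) : exists F : R -> 'rV[R]_n,
    continuous f -> [/\ F t0 = 0, continuous F &
      forall t, `|t - t0| < d -> is_derive t 1 F (f t *m A1 t)].
  have [cf|ncf] := pselect (continuous f); last by exists 0.
  by have [F FP] := antiderivative t0 d0 (cfA _ cf); exists F.
have PK f M : continuous f -> (forall t, `|t - t0| <= d -> `|f t| <= M) ->
    forall s t, `|s - t0| <= d -> `|t - t0| <= d ->
    `|P f s - P f t| <= K * M * `|s - t|.
  move=> cf fM; have [_ cP dP] := PE f cf.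
  apply: derivative_lipschitz d0 cP dP _ => t /fM tM.
  by rewrite (le_trans (mulK _ _)) // ler_pM2l.
have t0d : `|t0 - t0| <= d by rewrite subrr normr0 ltW.
have PB f g M : continuous f -> continuous g ->
    (forall t, `|t - t0| <= d -> `|f t - g t| <= M) ->
    forall t, `|t - t0| <= d -> `|P f t - P g t| <= M / 2.
  move=> cf cg fgM t td.
  have [f0 cPf dPf] := PE f cf; have [g0 cPg dPg] := PE g cg.
  have cPfg : continuous (P f - P g).
    by move=> s; apply: continuousB; [exact: cPf|exact: cPg].
  have dPfg s : `|s - t0| < d ->
      is_derive s 1 (P f - P g) (f s *m A1 s - g s *m A1 s).
    by move=> sd; apply: is_deriveB; [exact: dPf|exact: dPg].
  have M0 : 0 <= M by apply: le_trans (normr_ge0 _) (fgM _ t0d).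
  have := @derivative_lipschitz _ _ _ _ t0 d (K * M) d0 cPfg dPfg _ t t0 td t0d.
  rewrite !fctE /= f0 g0 !subr0 => H; apply: le_trans (H _) _.
    move=> s sd; rewrite -mulmxBl (le_trans (mulK _ _)) // ler_pM2l //.
    exact: fgM.
  rewrite mulrAC mulrC ler_wpM2l // (le_trans _ Kd) // ler_pM2l //.
(* Picard iterates; [d] is small enough for the integral operator to halve *)
(* distances.                                                              *)
pose u m : R -> 'rV[R]_n := iter m (fun f t => w + P f t) (cst w).
have uP m : continuous (u m) /\ forall t, `|t - t0| <= d ->
    `|u m t| <= 2 * `|w| /\ `|P (u m) t| <= `|w|.
  have Pw f : continuous f -> (forall t, `|t - t0| <= d -> `|f t| <= 2 * `|w|) ->
      forall t, `|t - t0| <= d -> `|P f t| <= `|w|.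
    move=> cf fw t td; have [Pf0 _ _] := PE f cf.
    have := PK f _ cf fw t t0 td t0d; rewrite Pf0 subr0 => H.
    apply: le_trans H _.
    have : K * (2 * `|w|) * `|t - t0| <= (2 * `|w|) * (K * d).
      by rewrite mulrAC [leRHS]mulrC ler_wpM2r ?mulr_ge0 // ler_pM2l.
    move=> H; apply: le_trans H _.
    by rewrite [2 * _]mulrC -mulrA ler_piMr // mulrC -ler_pdivlMr // mul1r.
  elim: m => [|m [cu IH]].
    have w2 : `|w| <= 2 * `|w| by rewrite mulr_natl mulr2n lerDl.
    have c0 : continuous (u 0%N) by move=> t; exact: cvg_cst.
    by split => // t td; split => //; apply: Pw.
  have cS : continuous (u m.+1).
    have [_ cP _] := PE _ cu.
    by move=> t; apply: continuousD; [exact: cvg_cst|exact: cP].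
  have bS t : `|t - t0| <= d -> `|u m.+1 t| <= 2 * `|w|.
    move=> /IH [_ Pm]; rewrite /= (le_trans (ler_normD _ _)) //.
    by rewrite mulr_natl mulr2n lerD2l.
  by split => // t td; split; [exact: bS|exact: Pw].
have uM m t : `|t - t0| <= d -> `|u m.+1 t - u m t| <= `|w| / 2 ^+ m.
  elim: m t => [|m IH] t td.
    rewrite expr0 divr1 /= /cst [w + _]addrC addrK.
    by have [_ /(_ t td) []] := uP 0%N.
  rewrite [u m.+2]/= [u m.+1]/= opprD addrACA subrr add0r.
  rewrite exprSr invfM mulrA; apply: PB td => //.
    by have [] := uP m.+1.
  by have [] := uP m.
have /choice [U UP] t : exists l : 'rV[R]_n, forall m,
    `|l - u m (clamp t0 d t)| <= 2 * `|w| / 2 ^+ m.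
  have cl := clamp_itv t0 t d0.
  have inc i m : `|u m.+1 (clamp t0 d t) 0 i - u m (clamp t0 d t) 0 i|
      <= `|w| / 2 ^+ m.
    apply: le_trans (uM m _ cl); have := rV_norm_ge
      (u m.+1 (clamp t0 d t) - u m (clamp t0 d t)) i.
    by rewrite !mxE.
  have /choice [l lP] i := limit_of_geometric_increments (inc i).
  exists (\row_i l i) => m; apply: rV_norm_le => [|i]; last by rewrite !mxE.
  by rewrite divr_ge0 ?mulr_ge0 ?exprn_ge0.
have UPS t m : `|U t - u m.+1 (clamp t0 d t)| <= `|w| / 2 ^+ m.
  apply: le_trans (UP t m.+1) _.
  by rewrite exprS -mulf_div divff ?mul1r // pnatr_eq0.
(* The iterates share one Lipschitz constant, which passes to the pointwise limit; this gives the
   continuity of [U]. *)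
have UL s t : `|U s - U t| <= K * (2 * `|w|) * `|s - t|.
  apply: (@le_of_geometric_error _ _ _ (2 * `|w|)) => m.
  have [cu uB] := uP m.
  have h : `|u m.+1 (clamp t0 d s) - u m.+1 (clamp t0 d t)|
      <= K * (2 * `|w|) * `|s - t|.
    rewrite /= opprD addrACA subrr add0r.
    apply: le_trans
      (PK _ (2 * `|w|) cu _ _ _ (clamp_itv t0 s d0) (clamp_itv t0 t d0)) _.
      by move=> x /uB [].
    by rewrite ler_wpM2l ?clamp_lipschitz // !mulr_ge0 // ltW.
  have hs := UPS s m; have ht := UPS t m; rewrite distrC in ht.
  have -> : U s - U t = (U s - u m.+1 (clamp t0 d s)) +
      ((u m.+1 (clamp t0 d s) - u m.+1 (clamp t0 d t)) +
       (u m.+1 (clamp t0 d t) - U t)) by rewrite !subrKA.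
  rewrite (le_trans (ler_normD _ _)) //.
  rewrite (le_trans (lerD hs (ler_normD _ _))) //.
  rewrite (le_trans (lerD (lexx _) (lerD h ht))) //.
  by rewrite addrCA lerD2l -mulrA mulr_natl mulr2n.
have cU := lipschitz_continuous UL.
have [PU0 cPU dPU] := PE U cU.
(* Both sides are compared with the iterate [u m.+1]; each of the two errors is at most [|w|] over 2
   to the power m. *)
have UE t : `|t - t0| <= d -> w + P U t = U t.
  move=> td; apply/eqP; rewrite -subr_eq0 -normr_le0.
  apply: (@le_of_geometric_error _ _ _ (2 * `|w|)) => m; rewrite add0r.
  have [cu _] := uP m.
  have UPc s : `|s - t0| <= d -> `|U s - u m s| <= 2 * `|w| / 2 ^+ m.
    by move=> sd; rewrite -{2}(clamp_id sd).
  have h1 := PB U (u m) _ cU cu UPc t td.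
  have h2 : `|u m.+1 t - U t| <= `|w| / 2 ^+ m.
    by rewrite distrC -{2}(clamp_id td).
  have -> : w + P U t - U t = (P U t - P (u m) t) + (u m.+1 t - U t).
    by rewrite /= addrA; congr (_ - _); rewrite addrCA -addrA addNr addr0.
  apply: le_trans (ler_normD _ _) _; move: h1 h2.
  by set a := `|w| / _ => h1 h2; rewrite -mulrA -/a in h1 *; lra.
exists d; split => //; first by rewrite ge_min e1e.

exists (fun t => w + P U t); split=> [|t td]; first by rewrite PU0 addr0.
rewrite UE ?ltW // -(tA1 t td) -[_ *m _]add0r.
apply: is_deriveD; exact: dPU.
Qed.

Lemma derive_scalar (W : normedModType R) (f : R^o -> W) x v :
  differentiable f x -> 'D_v f x = v *: 'D_1 f x.
Proof. by move=> df; rewrite !deriveE // -[v in LHS]mulr1 linearZ. Qed.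

(** Bootstrap: if the solution is of class C^k, the equation shows that its derivative is too. *)
Lemma smooth_on_ode_solution n (U : set R^o) (A : R^o -> 'M[R]_n)
    (W : R^o -> 'rV[R]_n) :
  open U -> smooth_on U A ->
  (forall t, U t -> is_derive t 1 W (W t *m A t)) -> smooth_on U W.
Proof.
move=> oU sA dW.
have df x : U x -> differentiable W x.
  by move=> Ux; apply/derivable1_diffP; have [] := dW x Ux.
elim=> [|k IH]; first by move=> x /df /differentiable_continuous.
split=> // v.
apply: (Ck_on_ext (f := fun x => v *: (W x *m A x))) => //.
  by move=> x Ux; rewrite derive_scalar; [have [_ ->] := dW x Ux|exact: df].
apply: (@Ck_on_lin _ _ _ _ k U (@GRing.scale R _ v)) => //.
  exact: scaler_continuous.
exact: Ck_on_mulmx.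
Qed.

End LinearODE.

(** * Smooth maps in coordinates *)


Section Jacobian.
Variable R : realType.

Lemma row_mulmx_inj m n (A B : 'M[R]_(m, n)) :
  (forall u : 'rV[R]_m, u *m A = u *m B) -> A = B.
Proof. by move=> AB; apply/row_matrixP => i; rewrite !rowE. Qed.

Lemma jacobian_comp m n p (f : 'rV[R]_m -> 'rV[R]_n) (g : 'rV[R]_n -> 'rV[R]_p) x :
  differentiable f x -> differentiable g (f x) ->
  'J (g \o f) x = 'J f x *m 'J g (f x).
Proof.
move=> df dg; apply: row_mulmx_inj => u; rewrite mulmxA.
rewrite -(deriveEjacobian u df) -(deriveEjacobian _ dg).
apply: etrans (esym (deriveEjacobian u (differentiable_comp df dg))) _.
exact: derive_comp.
Qed.

Lemma jacobian_near m n (f g : 'rV[R]_m -> 'rV[R]_n) x :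
  {near x, f =1 g} -> differentiable f x -> 'J f x = 'J g x.
Proof.
move=> fg df; have dg := differentiable_ext fg df.
apply: row_mulmx_inj => u.
apply: etrans (esym (deriveEjacobian u df)) (etrans _ (deriveEjacobian u dg)).
exact: near_eq_derive fg.
Qed.

Lemma jacobian_id m (x : 'rV[R]_m) : 'J id x = 1%:M.
Proof.
apply: row_mulmx_inj => u; rewrite mulmx1.
rewrite -deriveEjacobian; last exact: ex_diff.
exact: derive_id.
Qed.

Lemma open_preimage_on (S T : topologicalType) (f : S -> T) (A : set S) (B : set T) :
  open A -> open B -> (forall x, A x -> {for x, continuous f}) ->
  open (A `&` f @^-1` B).
Proof.
move=> oA oB cf; rewrite openE => x [Ax Bx]; apply: filterI.
  exact: open_nbhs_nbhs.
by apply: (cf x Ax); exact: open_nbhs_nbhs.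
Qed.

End Jacobian.

Section LocalRepresentation.
Context {R : realType}.

(** Stated for arbitrary charts, because the slice charts of a submanifold are admissible but need
    not belong to the given atlas. *)
Definition rep m n (S T : topologicalType) (phi : chart R m S) (psi : chart R n T)
  (F : S -> T) := psi \o F \o chart_inv phi.

Definition rep_dom m n (S T : topologicalType) (phi : chart R m S)
  (psi : chart R n T) (F : S -> T) :=
  phi @` (chart_dom phi `&` F @^-1` chart_dom psi).

Lemma rep_domE m n (S T : topologicalType) (phi : chart R m S)
    (psi : chart R n T) (F : S -> T) :
  rep_dom phi psi F
    = chart_im phi `&` chart_inv phi @^-1` (F @^-1` chart_dom psi).
Proof.
apply/seteqP; split => [_ [p [dp Fp] <-]|_ [[p dp <-]]] /=.
  by split; [exists p|rewrite chart_mapK].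
by rewrite chart_mapK // => Fp; exists p.
Qed.

Lemma open_rep_dom m n (S T : topologicalType) (phi : chart R m S)
    (psi : chart R n T) (F : S -> T) :
  continuous F -> open (rep_dom phi psi F).
Proof.
move=> cF; rewrite rep_domE.
apply: open_preimage_on; first exact: chart_im_open.
  apply: open_comp; first by move=> x _; exact: cF.
  exact: chart_dom_open.
exact: chart_inv_cont.
Qed.

Definition smooth_rep m n (S T : topologicalType) (phi : chart R m S)
  (psi : chart R n T) (F : S -> T) := smooth_on (rep_dom phi psi F) (rep phi psi F).

Lemma rep_comp_near m n k (S T X : topologicalType) (phi : chart R m S)
    (psi : chart R n T) (chi : chart R k X) (F : S -> T) (G : T -> X) p :
  continuous F -> chart_dom phi p -> chart_dom psi (F p) ->
  {near phi p, rep psi chi G \o rep phi psi F =1 rep phi chi (G \o F)}.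
Proof.
move=> cF dp dFp; have : nbhs (phi p) (rep_dom phi psi F).
  by apply: open_nbhs_nbhs; split; [exact: open_rep_dom|exists p].
apply: filterS => _ [q [dq dFq] <-].
by rewrite /rep /= chart_mapK // chart_mapK.
Qed.

Lemma smooth_rep_differentiable m n (S T : topologicalType) (phi : chart R m S)
    (psi : chart R n T) (F : S -> T) p :
  smooth_rep phi psi F -> chart_dom phi p -> chart_dom psi (F p) ->
  differentiable (rep phi psi F) (phi p).
Proof.
by move=> sF dp dFp; apply: (smooth_on_differentiable sF); exists p.
Qed.

Lemma jacobian_rep_comp m n k (S T X : topologicalType) (phi : chart R m S)
    (psi : chart R n T) (chi : chart R k X) (F : S -> T) (G : T -> X) p :
  continuous F -> chart_dom phi p -> chart_dom psi (F p) ->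
  chart_dom chi (G (F p)) ->
  smooth_rep phi psi F -> smooth_rep psi chi G ->
  'J (rep phi chi (G \o F)) (phi p)
    = 'J (rep phi psi F) (phi p) *m 'J (rep psi chi G) (psi (F p)).
Proof.
move=> cF dp dFp dGFp sF sG.
have dF := smooth_rep_differentiable sF dp dFp.
have E : rep phi psi F (phi p) = psi (F p) by rewrite /rep /= chart_mapK.
have dG : differentiable (rep psi chi G) (rep phi psi F (phi p)).
  by rewrite E; exact: smooth_rep_differentiable.
have near := rep_comp_near chi G cF dp dFp.
apply: etrans (esym (jacobian_near near (differentiable_comp dF dG))) _.
by apply: etrans (jacobian_comp dF dG) _; rewrite E.
Qed.

Lemma smooth_rep_comp m n k (S T X : topologicalType) (phi : chart R m S)
    (chi : chart R k X) (F : S -> T) (G : T -> X) :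
  continuous F -> continuous G ->
  (forall p, chart_dom phi p -> chart_dom chi (G (F p)) ->
     exists psi : chart R n T, [/\ chart_dom psi (F p), smooth_rep phi psi F &
       smooth_rep psi chi G]) ->
  smooth_rep phi chi (G \o F).
Proof.
move=> cF cG H; apply: smooth_on_local => _ [p [dp dGFp] <-].
have [psi [dFp sF sG]] := H p dp dGFp.
have cGF : continuous (G \o F) by
  move=> x; apply: continuous_comp; [exact: cF|exact: cG].
exists (rep_dom phi psi F `&` rep_dom phi chi (G \o F)).
  by split; exists p.
have oI : open (rep_dom phi psi F `&` rep_dom phi chi (G \o F)).
  by apply: openI; exact: open_rep_dom.
apply: (smooth_on_ext (f := rep psi chi G \o rep phi psi F)) => //.
  move=> x; rewrite !rep_domE => -[[_ Fx] [_ GFx]].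
  by rewrite /rep /= chart_mapK.
apply: (smooth_on_comp (U' := rep_dom psi chi G)) => //.
  move=> x; rewrite !rep_domE => -[[_ /= Fx] [_ /= GFx]].
  by rewrite /rep /=; split; [exists (F (chart_inv phi x))|rewrite /= chart_mapK].
by apply: smooth_onS sF => x [].
Qed.

End LocalRepresentation.

Section SmoothMaps.
Context {R : realType}.

Lemma smooth_map_id m (M : manifold R m) : smooth_map (@id M).
Proof. by split => [x|i j]; [exact: cvg_id|exact: atlas_compat]. Qed.

Lemma smooth_map_comp m n k (M : manifold R m) (N : manifold R n)
    (P : manifold R k) (F : M -> N) (G : N -> P) :
  smooth_map F -> smooth_map G -> smooth_map (G \o F).
Proof.
move=> [cF sF] [cG sG]; split => [x|i j].
  by apply: continuous_comp; [exact: cF|exact: cG].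
apply: (@smooth_rep_comp _ _ n) => // p _ _.
exists (atlas (chart_at (F p))); split; [exact: mem_chart_at|exact: sF|exact: sG].
Qed.

Definition tangent_map_coord m n (M : manifold R m) (N : manifold R n) (F : M -> N)
  i j p : 'M[R]_(m, n) := 'J (rep (atlas i) (atlas j) F) (atlas i p).

Lemma changeE m (M : manifold R m) (i j : chart_index M) p :
  change i j p = tangent_map_coord id i j p.
Proof. by []. Qed.

(** The chain rule in charts. As [change] is the case of the identity map, it also yields the
    cocycle law [change_comp] and the chart change rule [push_coord]. *)
Lemma tangent_map_coord_comp m n k (M : manifold R m) (N : manifold R n)
    (P : manifold R k) (F : M -> N) (G : N -> P) i j l p :
  smooth_map F -> smooth_map G -> chart_dom (atlas i) p ->
  chart_dom (atlas j) (F p) -> chart_dom (atlas l) (G (F p)) ->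
  tangent_map_coord (G \o F) i l p
    = tangent_map_coord F i j p *m tangent_map_coord G j l (F p).
Proof.
move=> [cF sF] [cG sG] ip jp lp.
exact: jacobian_rep_comp cF ip jp lp (sF i j) (sG j l).
Qed.

Lemma tangent_map_comp m n k (M : manifold R m) (N : manifold R n)
    (P : manifold R k) (F : M -> N) (G : N -> P) p :
  smooth_map F -> smooth_map G ->
  tangent_map (G \o F) p = tangent_map F p *m tangent_map G (F p).
Proof.
by move=> sF sG; apply: tangent_map_coord_comp => //; exact: mem_chart_at.
Qed.

Lemma change_comp m (M : manifold R m) (i j k : chart_index M) p :
  chart_dom (atlas i) p -> chart_dom (atlas j) p -> chart_dom (atlas k) p ->
  change i j p *m change j k p = change i k p.
Proof.
move=> ip jp kp; rewrite !changeE.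
exact/esym/(tangent_map_coord_comp (smooth_map_id M) (smooth_map_id M)).
Qed.

Lemma change_id m (M : manifold R m) (i : chart_index M) p :
  chart_dom (atlas i) p -> change i i p = 1%:M.
Proof.
move=> ip; rewrite -(jacobian_id (atlas i p)); apply/esym/jacobian_near => //.
have : nbhs (atlas i p) (chart_im (atlas i)).
  by apply: open_nbhs_nbhs; split; [exact: chart_im_open|exists p].
by apply: filterS => _ [q dq <-]; rewrite /transition /= chart_mapK.
Qed.

Lemma tangent_map_id m (M : manifold R m) (p : M) : tangent_map id p = 1%:M.
Proof. exact/change_id/mem_chart_at. Qed.

Lemma push_coord m n (M : manifold R m) (N : manifold R n) (F : M -> N) i j p v :
  smooth_map F -> chart_dom (atlas i) p -> chart_dom (atlas j) (F p) ->
  tangent_coord j (@push _ _ _ _ _ F p v)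
    = tangent_coord i v *m tangent_map_coord F i j p.
Proof.
move=> sF ip jp; rewrite /tangent_coord /push -!mulmxA !changeE.
have dp := mem_chart_at p; have dFp := mem_chart_at (F p).
rewrite -(tangent_map_coord_comp sF (smooth_map_id N) dp dFp jp).
by rewrite -(tangent_map_coord_comp (smooth_map_id M) sF dp ip jp).
Qed.

End SmoothMaps.

(** * Bump functions and one-forms *)


Section FlatFunction.
Variable R : realType.

(* With the factors s^-n the family is stable under differentiation up to      *)
(* linear combinations, so C^k for all n follows by induction on k.             *)
Definition flat_exp (n : nat) (s : R) : R :=
  if 0 < s then s^-1 ^+ n * expR (- s^-1) else 0.

Lemma flat_exp_pos n s : 0 < s -> flat_exp n s = s^-1 ^+ n * expR (- s^-1).
Proof. by rewrite /flat_exp => ->. Qed.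

Lemma flat_exp_nonpos n s : s <= 0 -> flat_exp n s = 0.
Proof. by rewrite /flat_exp ltNge => ->. Qed.

(** Write exp y as the (n+1)-st power of exp (y / (n+1)), and bound the latter below by y /
    (n+1). *)
Lemma exprn_expRN_le (y : R) n :
  0 < y -> y ^+ n.+1 * expR (- y) <= n.+1%:R ^+ n.+1.
Proof.
move=> y0; rewrite expRN ler_pdivrMr ?expR_gt0 //.
have n0 : 0 < n.+1%:R :> R by rewrite ltr0n.
have -> : expR y = expR (y / n.+1%:R) ^+ n.+1.
  by rewrite -expRM_natl mulrC divfK // gt_eqF.
have ey0 := expR_gt0 (y / n.+1%:R).
rewrite -exprMn; apply: lerXn2r; first exact: ltW.
  by rewrite nnegrE mulr_ge0 // ltW.
rewrite -ler_pdivrMl // mulrC; apply: le_trans (expR_ge1Dx _).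
by rewrite lerDr.
Qed.

(** This is [exprn_expRN_le] at y = 1/s with exponent n + 2. Quadratic decay is what makes the
    derivative at 0 vanish in [is_derive_flat_exp]. *)
Lemma flat_exp_le_sqr n : exists2 C, 0 < C & forall s, `|flat_exp n s| <= C * s ^+ 2.
Proof.
exists (n.+2%:R ^+ n.+2) => [|s]; first by rewrite exprn_gt0 // ltr0n.
have [s0|s0] := leP s 0; first by
  rewrite flat_exp_nonpos // normr0 mulr_ge0 ?sqr_ge0 // exprn_ge0.
have si0 : 0 <= s^-1 by rewrite invr_ge0 ltW.
rewrite flat_exp_pos // ger0_norm; last by rewrite mulr_ge0 ?exprn_ge0 ?expR_ge0.
rewrite -ler_pdivrMr ?exprn_gt0 // -exprVn mulrAC -exprD addn2.
by apply: exprn_expRN_le; rewrite invr_gt0.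
Qed.

Lemma is_derive_flat_exp n (s : R) :
  is_derive s 1 (flat_exp n) (flat_exp n.+2 s - n%:R * flat_exp n.+1 s).
Proof.
have [s0|s0|->] := ltgtP s 0.
- rewrite !flat_exp_nonpos ?ltW // mulr0 subrr.
  apply: (near_eq_is_derive (f := cst 0)).
  near=> t; rewrite flat_exp_nonpos // ltW //; near: t.
  by apply: (@open_nbhs_nbhs _ s [set t | t < 0]); split => //; exact: open_lt.
- rewrite !flat_exp_pos //.
  have s1 : s != 0 by rewrite gt_eqF.
  have dV : is_derive s 1 (fun t : R => t^-1) (- s ^- 2).
    have := @is_deriveV R id s 1 1 s1 (is_derive_id _ _).
    by rewrite -[- s ^- 2 *: 1]/(- s ^- 2 * 1) mulr1.
  have dE : is_derive s 1 (expR \o (fun t : R => - t^-1))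
      (expR (- s^-1) * (s ^- 2)).
    have dN : is_derive s 1 (fun t : R => - t^-1) (s ^- 2).
      by rewrite -[s ^- 2]opprK; apply: is_deriveN.
    exact: is_derive1_comp.
  have E : {near s, (fun t => t^-1) ^+ n * (expR \o (fun t => - t^-1)) =1 flat_exp n}.
    near=> t; rewrite flat_exp_pos; last first.
      near: t; apply: (@open_nbhs_nbhs _ s [set t | 0 < t]).
      by split => //; exact: open_gt.
    have XE (k : nat) : ((fun t : R => t^-1) ^+ k) t = t^-1 ^+ k.
      by elim: k => [//|k IH]; rewrite !exprS -IH.
    by rewrite -[LHS]/(((fun t : R => t^-1) ^+ n) t * expR (- t^-1)) XE.
  apply: (near_eq_is_derive E).
  apply: is_derive_eq (is_deriveM (is_deriveX n dV) dE) _.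
  have -> : ((fun t : R => t^-1) ^+ n) s = s^-1 ^+ n.
    by elim: n {E} => [//|k IH]; rewrite !exprS -IH.
  rewrite /= -!exprVn -![_ *: _]/(_ * _).
  by case: n {E} => [|k] /=; rewrite ?exprS; ring.
- rewrite !flat_exp_nonpos // mulr0 subrr.
  have [C C0 CP] := flat_exp_le_sqr n.
  have cv : h^-1 *: (flat_exp n (h *: 1 + 0) - flat_exp n 0) @[h --> 0^'] --> (0 : R).
    apply/cvgrPdist_lt => e e0; near=> h.
    rewrite sub0r normrN (flat_exp_nonpos n (lexx 0)) subr0 addr0.
    rewrite -[h *: 1]/(h * 1) mulr1 -[h^-1 *: _]/(h^-1 * _) normrM normfV.
    have h0 : 0 < `|h| by rewrite normr_gt0; near: h; exact: nbhs_dnbhs_neq.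
    rewrite mulrC ltr_pdivrMr //; apply: le_lt_trans (CP h) _.
    rewrite -real_normK ?num_real // expr2 mulrA ltr_pM2r // -ltr_pdivlMl //.
    by near: h; apply: dnbhs0_lt; rewrite mulr_gt0 // invr_gt0.
  by apply: DeriveDef; [apply/cvg_ex; exists 0|exact: cvg_lim cv].
Unshelve. all: by end_near. Qed.

Lemma Ck_on_flat_exp k n : Ck_on k [set: R^o] (flat_exp n : R^o -> R^o).
Proof.
have df m x : differentiable (flat_exp m : R^o -> R^o) x.
  by apply/derivable1_diffP; have [] := is_derive_flat_exp m x.
have oT : open [set: R^o] by exact: openT.
elim: k n => [|k IH] n; first by move=> x _; exact/differentiable_continuous.
split => // v.
apply: (Ck_on_ext (f := (fun x => (v : R^o) *: (flat_exp n.+2 x : R^o))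
    + (fun x => (- (v * n%:R) : R^o) *: (flat_exp n.+1 x : R^o)))) => //.
  move=> x _; rewrite derive_scalar //; have [_ ->] := is_derive_flat_exp n x.
  by rewrite fctE scalerBr scaleNr -[v *: (_ * _)]/(v * (_ * _)) mulrA.
apply: Ck_on_add => //; apply: (Ck_on_scale (a := cst _)) => //; exact: Ck_on_cst.
Qed.

(** The flat function is applied to r^2 minus the squared Euclidean distance, which is polynomial,
    and normalised by its value [t] at the centre. The Euclidean ball lies in the ball of the
    maximum norm. *)
Lemma smooth_bump n (y : 'rV[R]_n) (r : R) : 0 < r ->
  exists chi : 'rV[R]_n -> R^o, [/\ smooth_on setT chi, chi y = 1 &
    forall x, chi x != 0 -> `|x - y| <= r].
Proof.
move=> r0.
(* Kept as a 1 by 1 matrix because [Ck_on_comp] composes through row vectors. *)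
pose q (x : 'rV[R]_n) : 'rV[R]_1 := (r ^+ 2)%:M - (x - y) *m (x - y)^T.
have qE x : q x 0 0 = r ^+ 2 - \sum_i (x - y) 0 i ^+ 2.
  by rewrite !mxE eqxx mulr1n; congr (_ - _); apply: eq_bigr => i _; rewrite !mxE expr2.
have oT : open [set: 'rV[R]_n] by exact: openT.
have sB : smooth_on setT (fun x : 'rV[R]_n => x - y).
  move=> k; apply: (@Ck_on_add _ _ _ k setT idfun (cst (- y))) => //.
    by apply: (@Ck_on_linear _ _ _ k setT idfun) => // x; exact: cvg_id.
  exact: Ck_on_cst.
have sq : smooth_on setT q.
  move=> k; apply: (@Ck_on_add _ _ _ k setT (cst ((r ^+ 2)%:M))
      (fun x => - ((x - y) *m (x - y)^T))) => //; first exact: Ck_on_cst.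
  apply: (@Ck_on_lin _ _ _ _ k setT -%R) => //; first exact: continuous_linear_mx.
  apply: Ck_on_mulmx => //.
  apply: (@Ck_on_lin _ _ _ _ k setT trmx) => //; exact: continuous_linear_mx.
have st : smooth_on setT (fun M : 'rV[R]_1 => flat_exp 0 (M 0 0) : R^o).
  move=> k.
  have lin : linear (fun M : 'rV[R]_1 => M 0 0 : R^o) by move=> a M N; rewrite !mxE.
  pose c : {linear 'rV[R]_1 -> R^o} := HB.pack (fun M : 'rV[R]_1 => M 0 0 : R^o)
    (GRing.isLinear.Build _ _ _ _ _ lin).
  apply: (@Ck_on_lin_comp R R^o 'rV[R]_1 R^o R^o idfun c k setT setT
    (flat_exp 0)) => //.
  - by move=> x; exact: cvg_id.
  - exact: coord_continuous.
  - exact: openT.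
  - exact: Ck_on_flat_exp.
pose t := flat_exp 0 (r ^+ 2).
have t0 : t != 0.
  by rewrite /t flat_exp_pos ?exprn_gt0 // expr0 mul1r gt_eqF // expR_gt0.
exists (fun x => t^-1 *: (flat_exp 0 (q x 0 0) : R^o)); split.
- move=> k; apply: (@Ck_on_lin _ _ _ _ k setT (@GRing.scale R R^o t^-1)) => //.
    exact: scaler_continuous.
  exact: (Ck_on_comp (U' := setT) oT _ (sq k) (st k)).
- rewrite qE big1 ?subr0 => [|i _]; first by rewrite -[LHS]/(t^-1 * t) mulVf.
  by rewrite !mxE subrr expr0n.
- move=> x; rewrite -[_ *: _]/(t^-1 * _) mulf_eq0 invr_eq0 (negbTE t0) /= => qx.
  have qx0 : 0 < q x 0 0.
    by rewrite ltNge; apply: contra qx => /flat_exp_nonpos ->.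
  rewrite [leLHS]/Num.Def.normr /= mx_normrE.
  apply: bigmax_le => [|[i j] _]; first exact: ltW.
  rewrite ord1 /= -(@ler_pXn2r _ 2) ?nnegrE ?(ltW r0) //.
  rewrite -normrX ger0_norm ?sqr_ge0 //.
  move: qx0; rewrite qE subr_gt0 => /ltW; apply: le_trans.
  by rewrite (bigD1 j) //= lerDl sumr_ge0 // => k _; exact: sqr_ge0.
Qed.

End FlatFunction.


(** * Extending a covector to a global one-form *)

Section OneFormExtension.
Context {R : realType} {n : nat} (M : manifold R n).

Lemma closed_ball_subset_open (U : set 'rV[R]_n) y : open U -> U y ->
  exists2 r, 0 < r & forall x, `|x - y| <= r -> U x.
Proof.
move=> oU Uy; have /nbhs_ballP[r /= r0 rU] : nbhs y U.
  exact: open_nbhs_nbhs.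
exists (r / 2) => [|x xr]; first by rewrite divr_gt0.
apply: rU; rewrite -ball_normE /= distrC; apply: le_lt_trans xr _.
by rewrite ltr_pdivrMr // ltr_pMr // ltr1n.
Qed.

Lemma compact_closed_ball (y : 'rV[R]_n) r : compact [set x | `|x - y| <= r].
Proof.
apply: bounded_closed_compact.
  exists (`|y| + r); split; first exact: num_real.
  move=> s rs x /= xr; rewrite -[x](subrK y) (le_trans (ler_normD _ _)) //.
  by apply: le_trans (ltW rs); rewrite addrC lerD2l.
have -> : [set x | `|x - y| <= r] = (fun x => `|x - y|) @^-1` [set s | s <= r] by [].
apply: preimage_closed; last exact: closed_le.
move=> x _; have cB : {for x, continuous (fun z : 'rV[R]_n => z - y)}.
  apply: (@continuousB _ _ _ id (cst y)); first exact: cvg_id.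
  exact: cst_continuous.
exact: cvg_norm cB.
Qed.

(** Take the form with constant coefficients [a] in the chart at [p], multiply it by a bump function
    and extend by zero. *)
Lemma one_form_through (p : M) (a : cotangent p) : exists w : one_form M, w p = a.
Proof.
pose i0 := chart_at p; pose y := atlas i0 p.
have dp : chart_dom (atlas i0) p by exact: mem_chart_at.
have [r r0 rU] := closed_ball_subset_open (@chart_im_open _ _ _ (atlas i0))
  (imageP _ dp : (atlas i0 @` chart_dom (atlas i0)) y).
have [chi [schi chiy chir]] := smooth_bump y r0.
pose K : set M := chart_inv (atlas i0) @` [set x | `|x - y| <= r].
(* The support lies in a compact set, which is closed because [M] is Hausdorff; so the form vanishes
   on an open set around each point outside [K]. *)
have cK : closed K.
  apply: compact_closed; first exact: manifold_hausdorff.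
  apply: continuous_compact; last exact: compact_closed_ball.
  by apply: continuous_in_subspaceT => x; rewrite inE => /rU; exact: chart_inv_cont.
pose form q : cotangent q := if `[< chart_dom (atlas i0) q >]
  then chi (atlas i0 q) *: (change (chart_at q) i0 q *m a) else 0.
have form0 q : ~ K q -> form q = 0.
  rewrite /form; case: asboolP => // dq nKq.
  have [->|/chir xr] := eqVneq (chi (atlas i0 q)) 0; first by rewrite scale0r.
  by case: nKq; exists (atlas i0 q) => //; rewrite chart_mapK.
have formE i q : chart_dom (atlas i) q -> chart_dom (atlas i0) q ->
    cotangent_coord i (form q) = chi (atlas i0 q) *: (change i i0 q *m a).
  move=> iq i0q; rewrite /cotangent_coord /form; case: asboolP => // _.
  have E := change_comp iq (mem_chart_at q) i0q.
  apply: etrans (esym (scalemxAr _ _ _)) _.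
  by rewrite -E mulmxA.
have sform i : smooth_on (chart_im (atlas i)) (fun x =>
    cotangent_coord i (form (chart_inv (atlas i) x))).
  apply: smooth_on_local => _ [q iq <-].
  have [Kq|nKq] := pselect (K q).
    have i0q : chart_dom (atlas i0) q.
      case: Kq => x /= /rU [q' dq' <-] <-; by rewrite chart_mapK.
    exists (overlap (atlas i) (atlas i0)); first by exists q.
    have oo := @open_overlap _ _ _ (atlas i) (atlas i0).
    pose tau := transition (atlas i) (atlas i0).
    apply: (smooth_on_ext (f := fun x => chi (tau x) *: ('J tau x *m a))) => //.
      move=> _ [q' [dq' i0q'] <-]; rewrite chart_mapK // formE //.
      by rewrite /tau /transition /= chart_mapK.
    move=> k; apply: (@Ck_on_scale R _ _ k _ (chi \o tau)) => //.
      exact: (Ck_on_comp oo (fun _ _ => I) (atlas_compat i i0 k) (schi k)).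
    apply: (@Ck_on_mulmx R _ _ _ _ k _ (jacobian tau) (cst a)) => //.
      by apply: smooth_on_jacobian => //; exact: atlas_compat.
    exact: Ck_on_cst.
  have oU : open (chart_im (atlas i) `&` chart_inv (atlas i) @^-1` (~` K)).
    apply: open_preimage_on; [exact: chart_im_open|exact: closed_openC|].
    exact: chart_inv_cont.
  exists (chart_im (atlas i) `&` chart_inv (atlas i) @^-1` (~` K)).
    by split; [exists q|rewrite /= chart_mapK].
  apply: (smooth_on_ext (f := 0)) => // [x [_ /= nK]|k]; last exact: Ck_on_0.
  by rewrite form0 // /cotangent_coord mulmx0.
exists (OneForm sform) => /=.
rewrite /form; case: asboolP => // _.
by rewrite chiy scale1r change_id ?mul1mx.
Qed.

End OneFormExtension.

(** * Products *)


Section RowMx.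
Context {R : realType} {n1 n2 : nat} {V : normedModType R}.
Implicit Types (f : V -> 'rV[R]_n1) (g : V -> 'rV[R]_n2).

Lemma row_mx_mulmxr (u : 'rV[R]_n1) (v : 'rV[R]_n2) :
  row_mx u v = mulmxr (row_mx 1%:M 0) u + mulmxr (row_mx 0 1%:M) v.
Proof. by rewrite /= !mul_mx_row !mulmx1 !mulmx0 add_row_mx addr0 add0r. Qed.

Lemma smooth_on_row_mx (U : set V) f g : open U -> smooth_on U f ->
  smooth_on U g -> smooth_on U (fun x => row_mx (f x) (g x)).
Proof.
move=> oU sf sg; apply: (smooth_on_ext (f :=
  (mulmxr (row_mx 1%:M 0) \o f) + (mulmxr (row_mx 0 1%:M) \o g))) => //.
  by move=> x _; rewrite row_mx_mulmxr.
apply: smooth_on_add => //; apply: smooth_on_lin => //;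
  exact: continuous_linear_mx.
Qed.

Lemma derive_row_mx f g x v : differentiable f x -> differentiable g x ->
  'D_v (fun x => row_mx (f x) (g x)) x = row_mx ('D_v f x) ('D_v g x).
Proof.
move=> df dg.
have -> : (fun x => row_mx (f x) (g x)) =
  (mulmxr (row_mx 1%:M 0) \o f) + (mulmxr (row_mx 0 1%:M) \o g).
  by apply/funext => y; rewrite row_mx_mulmxr.
have cid : continuous (idfun : V -> V) by move=> y; exact: cvg_id.
have [d1 E1] := derive_lin_comp (A := mulmxr (row_mx 1%:M (0 : 'M_(n1, n2))))
  (B := idfun) v (@continuous_linear_mx _ _ _ _ _) cid df.
have [d2 E2] := derive_lin_comp (A := mulmxr (row_mx (0 : 'M_(n2, n1)) 1%:M))
  (B := idfun) v (@continuous_linear_mx _ _ _ _ _) cid dg.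
rewrite deriveD; [|exact: diff_derivable|exact: diff_derivable].
by rewrite E1 E2 row_mx_mulmxr.
Qed.

End RowMx.

Lemma differentiable_row_mx {R : realType} n1 n2 (V : normedModType R)
    (f : V -> 'rV[R]_n1) (g : V -> 'rV[R]_n2) x :
  differentiable f x -> differentiable g x ->
  differentiable (fun x => row_mx (f x) (g x)) x.
Proof.
move=> df dg.
have -> : (fun x => row_mx (f x) (g x)) =
  (mulmxr (row_mx 1%:M 0) \o f) + (mulmxr (row_mx 0 1%:M) \o g).
  by apply/funext => y; rewrite row_mx_mulmxr.
apply: differentiableD; apply: differentiable_comp => //;
  apply: linear_differentiable; exact: continuous_linear_mx.
Qed.

Lemma jacobian_row_mx {R : realType} m n1 n2 (f : 'rV[R]_m -> 'rV[R]_n1)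
    (g : 'rV[R]_m -> 'rV[R]_n2) x :
  differentiable f x -> differentiable g x ->
  'J (fun x => row_mx (f x) (g x)) x = row_mx ('J f x) ('J g x).
Proof.
move=> df dg; apply: row_mulmx_inj => u; rewrite mul_mx_row.
apply: etrans (esym (deriveEjacobian u (differentiable_row_mx df dg))) _.
apply: etrans (derive_row_mx u df dg) _.
by congr row_mx; exact: deriveEjacobian.
Qed.

Section ProductMaps.
Context {R : realType} {n1 n2 : nat} (M1 : manifold R n1) (M2 : manifold R n2).
Let P := prod_manifold M1 M2.

Lemma smooth_map_fst : smooth_map (fst : P -> M1).
Proof.
split=> [x|i j]; first exact: cvg_fst.
move=> k; apply: (@Ck_on_lin_comp R _ _ _ _ idfun (@lsubmx R 1 n1 n2) k
  (overlap (atlas i.1) (atlas j)) _ (transition (atlas i.1) (atlas j))).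
- by move=> x; exact: cvg_id.
- exact: continuous_linear_mx.
- by apply: (@open_rep_dom _ _ _ P M1) => x; exact: cvg_fst.
- move=> _ [[p q] [[/= ip iq] jp] <-].
  by exists p => //; rewrite /prod_map row_mxKl.
- exact: atlas_compat.
Qed.

Variables (m : nat) (N : manifold R m) (f : N -> M1) (g : N -> M2).
Hypotheses (sf : smooth_map f) (sg : smooth_map g).

Lemma continuous_pair_map : continuous (fun q => (f q, g q) : P).
Proof. by case: sf sg => cf _ [cg _] x; exact: cvg_pair (cf x) (cg x). Qed.

Lemma smooth_map_pair : smooth_map (fun q => (f q, g q) : P).
Proof.
split=> [|i j]; first exact: continuous_pair_map.
have oD := open_rep_dom (phi := atlas i) (psi := atlas j) continuous_pair_map.
case: sf sg => _ sf' [_ sg'].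
apply: (@smooth_on_row_mx _ _ _ _ _ (rep (atlas i) (atlas j.1) f)
  (rep (atlas i) (atlas j.2) g)) => //.
  by apply: smooth_onS (sf' i j.1) => _ [q [iq [/= fq gq]] <-]; exists q.
by apply: smooth_onS (sg' i j.2) => _ [q [iq [/= fq gq]] <-]; exists q.
Qed.

Lemma tangent_map_coord_pair i j q : chart_dom (atlas i) q ->
  chart_dom (atlas j.1) (f q) -> chart_dom (atlas j.2) (g q) ->
  tangent_map_coord (fun q => (f q, g q) : P) i j q
    = row_mx (tangent_map_coord f i j.1 q) (tangent_map_coord g i j.2 q).
Proof.
case: sf sg => _ sf' [_ sg'] iq fq gq.
apply: (jacobian_row_mx (f := rep (atlas i) (atlas j.1) f)
  (g := rep (atlas i) (atlas j.2) g)).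
  exact: smooth_rep_differentiable (sf' i j.1) iq fq.
exact: smooth_rep_differentiable (sg' i j.2) iq gq.
Qed.

Lemma tangent_map_pair q : tangent_map (fun q => (f q, g q) : P) q
  = row_mx (tangent_map f q) (tangent_map g q).
Proof.
exact: (tangent_map_coord_pair (j := (chart_at (f q), chart_at (g q)))
  (mem_chart_at q) (mem_chart_at (f q)) (mem_chart_at (g q))).
Qed.

End ProductMaps.

Section Curves.
Context {R : realType} {n : nat} {M : manifold R n}.

Lemma open_curve_dom (a b : R) (c : R -> M) (A : set M) :
  (forall t, a < t < b -> {for t, continuous c}) -> open A ->
  open (`]a, b[ `&` c @^-1` A : set R^o).
Proof.
by move=> cc oA; apply: open_preimage_on.
Qed.

Lemma smooth_curve_comp m (N : manifold R m) (F : M -> N) a b (c : R -> M) :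
  smooth_map F -> smooth_curve a b c -> smooth_curve a b (F \o c).
Proof.
move=> [cF sF] [cc sc]; split=> [t tab|j].
  by apply: continuous_comp; [exact: cc|exact: cF].
have oF : open (F @^-1` chart_dom (atlas j)).
  by apply: open_comp; [move=> x _; exact: cF|exact: chart_dom_open].
apply: smooth_on_local => t [tab jt]; pose i := chart_at (c t).
have it : chart_dom (atlas i) (c t) by exact: mem_chart_at.
pose A := chart_dom (atlas i) `&` F @^-1` chart_dom (atlas j).
have oA : open A by apply: openI => //; exact: chart_dom_open.
exists (`]a, b[ `&` c @^-1` A) => //.
apply: (smooth_on_ext (f := rep (atlas i) (atlas j) F \o (atlas i \o c : R^o -> _))).
- exact: open_curve_dom.
- by move=> s [_ [/= is_ js]]; rewrite /rep /= chart_mapK.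
- apply: (smooth_on_comp (U' := rep_dom (atlas i) (atlas j) F)).
  + exact: open_curve_dom.
  + by move=> s [_ [/= is_ js]]; exists (c s).
  + by apply: smooth_onS (sc i) => s [sab [is_ _]].
  + exact: sF.
Qed.

Lemma smooth_curveS a b a' b' (c : R -> M) : a <= a' -> b' <= b ->
  smooth_curve a b c -> smooth_curve a' b' c.
Proof.
move=> aa bb [cc sc]; split=> [t /andP[ta tb]|i].
  by apply: cc; rewrite (le_lt_trans aa) // (lt_le_trans tb).
apply: smooth_onS (sc i) => t [/=]; rewrite !in_itv /= => /andP[ta tb] it.
by rewrite (le_lt_trans aa) // (lt_le_trans tb).
Qed.

Lemma smooth_curve_differentiable a b (c : R -> M) i t :
  smooth_curve a b c -> a < t < b -> chart_dom (atlas i) (c t) ->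
  differentiable (atlas i \o c : R^o -> _) t.
Proof.
move=> [_ sc] tab it; apply: (smooth_on_differentiable (sc i)).
by split => //=; rewrite in_itv.
Qed.

End Curves.


Section ParallelProduct.
Context {R : realType} {n1 n2 : nat} (M1 : manifold R n1) (M2 : manifold R n2).
Let P := prod_manifold M1 M2.

Lemma change_prod (i j : chart_index P) (p : P) :
  chart_dom (atlas i) p -> chart_dom (atlas j) p ->
  change i j p = block_mx (change i.1 j.1 p.1) 0 0 (change i.2 j.2 p.2).
Proof.
move=> ip jp; apply: etrans (prod_jacobianE _) _; first by exists p.
by rewrite /block_map /= /prod_map row_mxKl row_mxKr.
Qed.

Lemma tangent_coord_prod (i : chart_index P) (p : P) v1 v2 :
  chart_dom (atlas i) p ->
  tangent_coord i (row_mx v1 v2 : tangent p)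
    = row_mx (tangent_coord i.1 (v1 : tangent p.1))
             (tangent_coord i.2 (v2 : tangent p.2)).
Proof.
move=> ip; rewrite /tangent_coord.
apply: etrans (congr1 _ (change_prod (mem_chart_at p) ip)) _.
by rewrite mul_row_block !mulmx0 addr0 add0r.
Qed.

Variables (D1 : connection M1) (D2 : connection M2).
Variables (a b : R) (c1 : R -> M1) (c2 : R -> M2).
Variables (V1 : forall t, tangent (c1 t)) (V2 : forall t, tangent (c2 t)).
Hypotheses (sc1 : smooth_curve a b c1) (sc2 : smooth_curve a b c2).

Let c t : P := (c1 t, c2 t).
Let V t : tangent (c t) := row_mx (V1 t) (V2 t).

Let cc t : a < t < b -> {for t, continuous c}.
Proof.
by move=> tab; case: sc1 sc2 => h1 _ [h2 _]; exact: cvg_pair (h1 t tab) (h2 t tab).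
Qed.

Let dom i : set R^o := `]a, b[ `&` c @^-1` chart_dom (atlas i).

Let open_dom i : open (dom i).
Proof. by apply: open_curve_dom => //; exact: chart_dom_open. Qed.

Let fieldE i t : dom i t ->
  row_mx (field_local V1 i.1 t) (field_local V2 i.2 t) = field_local V i t.
Proof. by move=> [_ it]; rewrite /field_local tangent_coord_prod. Qed.

Let smooth_fieldE i : smooth_on (dom i) (field_local V i) <->
  smooth_on (dom i) (field_local V1 i.1) /\ smooth_on (dom i) (field_local V2 i.2).
Proof.
split=> [sV|[sV1 sV2]]; last first.
  apply: (smooth_on_ext (f := fun t =>
      row_mx (field_local V1 i.1 t) (field_local V2 i.2 t))) => //.
    exact: fieldE.
  exact: smooth_on_row_mx.
have oi := @open_dom i; split.
  apply: (smooth_on_ext (f := lsubmx \o field_local V i)) => //.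
    by move=> t /fieldE /= <-; rewrite row_mxKl.
  by apply: smooth_on_lin => //; exact: continuous_linear_mx.
apply: (smooth_on_ext (f := rsubmx \o field_local V i)) => //.
  by move=> t /fieldE /= <-; rewrite row_mxKr.
by apply: smooth_on_lin => //; exact: continuous_linear_mx.
Qed.

Let parallel_eqE i t : dom i t -> smooth_on (dom i) (field_local V i) ->
  derive1 (field_local V i) t + field_local V i t
    *m prod_connection D1 D2 i (atlas i (c t)) (derive1 (atlas i \o c) t)
  = row_mx
    (derive1 (field_local V1 i.1) t + field_local V1 i.1 t
      *m D1 i.1 (atlas i.1 (c1 t)) (derive1 (atlas i.1 \o c1) t))
    (derive1 (field_local V2 i.2) t + field_local V2 i.2 t
      *m D2 i.2 (atlas i.2 (c2 t)) (derive1 (atlas i.2 \o c2) t)).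
Proof.
move=> dt /smooth_fieldE [sV1 sV2]; have [tab [/= d1 d2]] := dt.
move: tab; rewrite /= in_itv /= => tab.
have E : derive1 (field_local V i) t
    = row_mx (derive1 (field_local V1 i.1) t) (derive1 (field_local V2 i.2) t).
  rewrite !derive1E -(derive_row_mx (1 : R^o)
    (smooth_on_differentiable sV1 dt) (smooth_on_differentiable sV2 dt)).
  apply: near_eq_derive.
  have : nbhs t (dom i) by apply: open_nbhs_nbhs.
  by apply: filterS => s /fieldE.
have E' : derive1 (atlas i \o c) t
    = row_mx (derive1 (atlas i.1 \o c1) t) (derive1 (atlas i.2 \o c2) t).
  rewrite !derive1E -(derive_row_mx (1 : R^o)
    (smooth_curve_differentiable sc1 tab d1)
    (smooth_curve_differentiable sc2 tab d2)) //.
rewrite E E' -(fieldE dt) /= /prod_omega /prod_map !row_mxKl !row_mxKr.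
by rewrite mul_row_block !mulmx0 addr0 add0r add_row_mx.
Qed.

(** In product charts the connection forms are block diagonal, so the transport equation splits into
    its two components. To read off one component in a given chart, any chart around the current
    point of the other factor is adjoined; smoothness is local, so that chart may vary with the
    time. *)
Lemma parallel_along_prod :
  parallel_along (prod_connection D1 D2) a b V <->
  parallel_along D1 a b V1 /\ parallel_along D2 a b V2.
Proof.
split=> [[sV pV]|[[sV1 pV1] [sV2 pV2]]]; last first.
  have sV i : smooth_on (dom i) (field_local V i).
    apply/smooth_fieldE; split.
      by apply: smooth_onS (sV1 i.1) => t [tab []].
    by apply: smooth_onS (sV2 i.2) => t [tab []].
  split=> // i t tab it; have [/= d1 d2] := it.
  rewrite parallel_eqE //.
  by rewrite pV1 // pV2 // row_mx0.
have pV' i t : a < t < b -> chart_dom (atlas i) (c t) -> _ := fun tab it =>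
  etrans (esym (@parallel_eqE i t (conj tab it) (sV i))) (pV i t tab it).
split.
- split=> [i|i t tab it].
    apply: smooth_on_local => t [tab it]; pose i2 := chart_at (c2 t).
    exists (dom (i, i2)); first by split => //; split => //; exact: mem_chart_at.
    by have /smooth_fieldE [] := sV (i, i2).
  have dt : chart_dom (atlas ((i, chart_at (c2 t)) : chart_index P)) (c t).
    by split => //; exact: mem_chart_at.
  by move: (pV' _ t tab dt); rewrite -row_mx0 => /eq_row_mx [].
- split=> [i|i t tab it].
    apply: smooth_on_local => t [tab it]; pose i1 := chart_at (c1 t).
    exists (dom (i1, i)); first by split => //; split => //; exact: mem_chart_at.
    by have /smooth_fieldE [] := sV (i1, i).
  have dt : chart_dom (atlas ((chart_at (c1 t), i) : chart_index P)) (c t).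
    by split => //; exact: mem_chart_at.
  by move: (pV' _ t tab dt); rewrite -row_mx0 => /eq_row_mx [].
Qed.

End ParallelProduct.

(** * The inclusion of a graph *)


Section ChartChange.
Context {R : realType} {n : nat} {T : topologicalType} (chi : chart R n T).
Variables (O O' : set 'rV[R]_n) (f f' : 'rV[R]_n -> 'rV[R]_n).
Hypotheses (oO : open O) (oO' : open O').
Hypotheses (cf : forall x, O x -> {for x, continuous f})
           (cf' : forall x, O' x -> {for x, continuous f'}).
Hypotheses (fO : forall x, O x -> O' (f x)) (fO' : forall x, O' x -> O (f' x)).
Hypotheses (fK : forall x, O x -> f' (f x) = x)
           (fK' : forall x, O' x -> f (f' x) = x).

Let dom : set T := chart_dom chi `&` chi @^-1` O.

Let imE : (f \o chi) @` dom = O' `&` f' @^-1` chart_im chi.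
Proof.
apply/seteqP; split => [_ [p [dp Op] <-]|x [Ox' [p dp px]]] /=.
  by split; [exact: fO|rewrite /= fK //; exists p].
have Op : O (chi p) by rewrite px; exact: fO'.
by exists p => //=; rewrite px fK'.
Qed.

Lemma chart_change_dom_open : open dom.
Proof.
by apply: open_preimage_on oO _; [exact: chart_dom_open|exact: chart_map_cont].
Qed.

Lemma chart_change_im_open : open ((f \o chi) @` dom).
Proof. by rewrite imE; apply: open_preimage_on => //; exact: chart_im_open. Qed.

Lemma chart_change_mapK p : dom p -> (chart_inv chi \o f') ((f \o chi) p) = p.
Proof. by move=> [dp Op] /=; rewrite fK // chart_mapK. Qed.

Lemma chart_change_map_cont p : dom p -> {for p, continuous (f \o chi)}.
Proof.
by move=> [dp Op]; apply: continuous_comp; [exact: chart_map_cont|exact: cf].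
Qed.

Lemma chart_change_inv_cont x : ((f \o chi) @` dom) x ->
  {for x, continuous (chart_inv chi \o f')}.
Proof.
rewrite imE => -[Ox' im]; apply: continuous_comp; first exact: cf'.
exact: chart_inv_cont.
Qed.

(** Here [f] is a homeomorphism from [O] onto [O'] with inverse [f']; the domain of the chart is cut
    down to the points whose coordinates lie in [O]. *)
Definition chart_change : chart R n T :=
  Chart chart_change_dom_open chart_change_im_open chart_change_mapK
    chart_change_map_cont chart_change_inv_cont.

End ChartChange.

Lemma admissible_chart_change {R : realType} n (M : manifold R n)
    (i : chart_index M) O O' f f' (oO : open O) (oO' : open O') cf cf'
    (fO : forall x, O x -> O' (f x)) (fO' : forall x, O' x -> O (f' x)) fK fK' :
  smooth_on O f -> smooth_on O' f' ->
  admissible (@chart_change R n M (atlas i) O O' f f' oO oO' cf cf' fO fO' fK fK').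
Proof.
move=> sf sf' j; split.
  apply: (@smooth_on_comp _ _ _ _ _ (overlap (atlas i) (atlas j)) f'
    (transition (atlas i) (atlas j))).
  - exact: open_overlap.
  - by move=> _ [p [[/= ip Op] jp] <-]; rewrite /= fK //; exists p.
  - by apply: smooth_onS sf' => _ [p [[/= ip Op] jp] <-]; exact: fO.
  - exact: atlas_compat.
apply: (@smooth_on_comp _ _ _ _ _ O (transition (atlas j) (atlas i)) f) => //.
- exact: open_overlap.
- by move=> _ [p [jp [/= ip Op]] <-]; rewrite /transition /= chart_mapK.
- by apply: smooth_onS (atlas_compat j i) => _ [p [jp [/= ip Op]] <-]; exists p.
Qed.

Section GraphInclusion.
Context {R : realType} {n1 n2 : nat} {M1 : manifold R n1} {M2 : manifold R n2}.
Variables (F : M1 -> M2) (smF : smooth_map F).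

Definition graph_map (p : M1) : prod_manifold M1 M2 := (p, F p).

Lemma smooth_graph_map : smooth_map graph_map.
Proof. exact: smooth_map_pair (smooth_map_id M1) smF. Qed.

Lemma push_graph_map p v :
  push graph_map v = row_mx v (@push _ _ _ _ _ F p v).
Proof.
rewrite /push (tangent_map_pair (smooth_map_id M1) smF) tangent_map_id.
by rewrite mul_mx_row mulmx1.
Qed.

Lemma range_graph_map : range graph_map = graph F.
Proof.
apply/seteqP; split => [_ [p _ <-] //|[p q] /= pq].
by exists p => //; rewrite /graph_map -pq.
Qed.

Section Shear.
Variables (i : chart_index M1) (j : chart_index M2).

Let Fh := rep (atlas i) (atlas j) F.
Let U := rep_dom (atlas i) (atlas j) F.
Let O : set 'rV[R]_(n1 + n2) := lsubmx @^-1` U.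

Let oU : open U. Proof. by apply: open_rep_dom; case: smF. Qed.

Let oO : open O.
Proof. by apply: open_comp oU => x _; exact: continuous_lsubmx. Qed.

(* [shear (-1)] straightens the graph of [F] in coordinates to the slice        *)
(* R^n1 x 0.                                                                    *)
Let shear (e : R) (x : 'rV[R]_(n1 + n2)) : 'rV[R]_(n1 + n2) :=
  row_mx (lsubmx x) (rsubmx x + e *: Fh (lsubmx x)).

Let smooth_shear e : smooth_on O (shear e).
Proof.
have sl : smooth_on O lsubmx.
  by move=> k; apply: Ck_on_linear => //; exact: continuous_linear_mx.
have sr : smooth_on O rsubmx.
  by move=> k; apply: Ck_on_linear => //; exact: continuous_linear_mx.
apply: smooth_on_row_mx => //; apply: smooth_on_add => //.
apply: (smooth_on_lin (A := *:%R e) (f := Fh \o lsubmx)) => //.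
  exact: scaler_continuous.
by apply: (smooth_on_comp (U' := U)) => //; exact: smF.2.
Qed.

Let shearO e x : O x -> O (shear e x).
Proof. by rewrite /O /= row_mxKl. Qed.

Let shearK e x : shear (- e) (shear e x) = x.
Proof.
by rewrite /shear row_mxKl row_mxKr scaleNr addrK hsubmxK.
Qed.

Let shear_cont e x (Ox : O x) : {for x, continuous (shear e)} :=
  smooth_on_continuous (@smooth_shear e) Ox.

Let phi : chart R (n1 + n2) (prod_manifold M1 M2) :=
  chart_change (atlas ((i, j) : chart_index (prod_manifold M1 M2)))
    oO oO (@shear_cont (-1)) (@shear_cont (1))
    (@shearO (-1)) (@shearO (1))
    (fun x _ => etrans (congr1 (fun e => shear e (shear (-1) x)) (esym (opprK 1)))
       (shearK (-1) x))
    (fun x _ => shearK 1 x).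

Let id_cont (x : 'rV[R]_n1) (_ : U x) : {for x, continuous idfun}.
Proof. exact: cvg_id. Qed.

(** Changing by the identity only shrinks the domain, to the points that [F] sends into the domain
    of the chart [j]. This makes it exactly the preimage of the domain of [phi]. *)
Let psi : chart R n1 M1 :=
  chart_change (atlas i) oU oU id_cont id_cont
    (fun _ => id) (fun _ => id) (fun _ _ => erefl) (fun _ _ => erefl).

Let UE p : chart_dom (atlas i) p -> U (atlas i p) <-> chart_dom (atlas j) (F p).
Proof.
move=> ip; rewrite /U rep_domE /= chart_mapK //.
by split=> [[]|] //; split=> //; exists p.
Qed.

Lemma graph_map_slice p : chart_dom (atlas i) p -> chart_dom (atlas j) (F p) ->
  exists (phi : chart R (n1 + n2) (prod_manifold M1 M2)) (psi : chart R n1 M1),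
    [/\ admissible phi /\ admissible psi, chart_dom phi (graph_map p),
        chart_dom psi = graph_map @^-1` chart_dom phi,
        (forall q, chart_dom psi q -> phi (graph_map q) = psi q *m pid_mx n1) &
        phi @` (chart_dom phi `&` range graph_map)
          = chart_im phi `&` range (fun x : 'rV[R]_n1 => x *m pid_mx n1)].
Proof.
move=> ip jp; exists phi, psi.
have pidE (x : 'rV[R]_n1) : x *m pid_mx n1 = row_mx x (0 : 'rV_n2).
  by rewrite pid_mx_row mul_mx_row mulmx1 mulmx0.
have slice q : chart_dom psi q -> phi (graph_map q) = psi q *m pid_mx n1.
  move=> [iq Uq]; rewrite pidE /= /shear /prod_map /= row_mxKl row_mxKr.
  by rewrite /Fh /rep /= chart_mapK // scaleN1r subrr.
have dE : chart_dom psi = graph_map @^-1` chart_dom phi.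
  apply/seteqP; split => q /=.
    move=> [iq Uq]; split; first by split => //=; apply/UE.
    by rewrite /O /= /prod_map row_mxKl.
  by move=> [[/= iq jq] _]; split => //=; apply/UE.
split => //.
- split; apply: admissible_chart_change => //.
  by move=> k; apply: (@Ck_on_linear _ _ _ k U idfun) => // x; exact: cvg_id.
  by move=> k; apply: (@Ck_on_linear _ _ _ k U idfun) => // x; exact: cvg_id.
- have : chart_dom psi p by split => //=; apply/UE.
  by rewrite dE.
apply/seteqP; split => [_ [z [dz [q _ qz]] <-]|_ [[z dz <-] [x _ xz]]].
  rewrite -qz in dz *; split; first by exists (graph_map q).
  by exists (psi q) => //; rewrite slice // dE.
(* Vanishing of the last coordinates says that [r] and [F q] have the same coordinates in the chart
   [j], hence coincide. *)
exists z => //; split => //; case: z dz xz => q r [[/= iq jr] Oq].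
rewrite pidE /= /shear /prod_map /= row_mxKl row_mxKr => /eq_row_mx [_ /esym/eqP].
rewrite scaleN1r subr_eq0 /Fh /rep /= chart_mapK // => /eqP E.
have jq : chart_dom (atlas j) (F q).
  by apply/UE => //; move: Oq; rewrite /O /= /prod_map row_mxKl.
by exists q => //; rewrite /graph_map -(chart_mapK jq) -E chart_mapK.
Qed.

End Shear.

Lemma submanifold_inclusion_graph_map : submanifold_inclusion graph_map.
Proof.
split => [|p q [] //|p]; first exact: leq_addr.
exact: graph_map_slice (mem_chart_at p) (mem_chart_at (F p)).
Qed.

End GraphInclusion.

(** * Parallel fields along curves *)


Section ParallelExt.
Context {R : realType} {n : nat} {M : manifold R n}.
Implicit Types (c : R -> M).

Lemma parallel_along_ext (D : connection M) a b c c' (V : forall t, tangent (c t))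
    (V' : forall t, tangent (c' t)) :
  c = c' -> (forall t, V t = V' t :> 'rV[R]_n) ->
  parallel_along D a b V -> parallel_along D a b V'.
Proof.
move=> cc; subst c' => VV; suff -> : V = V' by [].
exact: functional_extensionality_dep.
Qed.

End ParallelExt.

Section CurveDom.
Context {R : realType} {n : nat} {M : manifold R n}.
Implicit Types (c : R -> M).

Definition curve_dom (a b : R) c i : set R^o :=
  `]a, b[ `&` c @^-1` chart_dom (atlas i).

Lemma open_curve_chart_dom a b c i : smooth_curve a b c -> open (curve_dom a b c i).
Proof. by case=> cc _; apply: open_curve_dom => //; exact: chart_dom_open. Qed.

End CurveDom.

Section ParallelFields.
Context {R : realType} {n : nat} {M : manifold R n}.
Implicit Types (c : R -> M).

Lemma smooth_tangent_map_coord_curve m (N : manifold R m) (F : M -> N) a b c i j :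
  smooth_map F -> smooth_curve a b c ->
  smooth_on (curve_dom a b c i `&` (F \o c) @^-1` chart_dom (atlas j))
    (fun t => tangent_map_coord F i j (c t)).
Proof.
move=> sF sc; have [cF rF] := sF.
have sFc := smooth_curve_comp sF sc.
have oS : open (curve_dom a b c i `&` (F \o c) @^-1` chart_dom (atlas j) : set R^o).
  have -> : (curve_dom a b c i `&` (F \o c) @^-1` chart_dom (atlas j) : set R^o)
      = curve_dom a b c i `&` curve_dom a b (F \o c) j.
    by apply/seteqP; split => t /= [[? ?]]; [|case].
  by apply: openI; exact: open_curve_chart_dom.
apply: (@smooth_on_comp _ _ _ _ _ (rep_dom (atlas i) (atlas j) F)
  (atlas i \o c : R^o -> _) (jacobian (rep (atlas i) (atlas j) F))) => //.
- by move=> t [[_ it] jt]; exists (c t).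
- by apply: smooth_onS (sc.2 i) => t [].
- by apply: smooth_on_jacobian (rF i j); exact: open_rep_dom.
Qed.

Section Push.
Variables (m : nat) (N : manifold R m) (F : M -> N) (a b : R) (c : R -> M).
Variables (V : forall t, tangent (c t)).
Hypotheses (sF : smooth_map F) (sc : smooth_curve a b c).
Hypothesis sV : forall i, smooth_on (curve_dom a b c i) (field_local V i).

Let pushV t : tangent (F (c t)) := push F (V t).

Let dom i j : set R^o := curve_dom a b c i `&` (F \o c) @^-1` chart_dom (atlas j).

Let open_dom i j : open (dom i j).
Proof.
have -> : dom i j = curve_dom a b c i `&` curve_dom a b (F \o c) j.
  by apply/seteqP; split => t /= [[? ?]]; [|case].
by apply: openI; apply: open_curve_chart_dom => //; exact: smooth_curve_comp.
Qed.

Let pushE i j t : dom i j t ->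
  field_local V i t *m tangent_map_coord F i j (c t) = field_local pushV j t.
Proof. by move=> [[_ it] jt]; apply/esym/push_coord. Qed.

Lemma smooth_push_field j : smooth_on (curve_dom a b (F \o c) j) (field_local pushV j).
Proof.
apply: smooth_on_local => t [tab jt]; pose i := chart_at (c t).
have dt : dom i j t by do !split => //; exact: mem_chart_at.
exists (dom i j) => //.
apply: (smooth_on_ext (f := fun t =>
  field_local V i t *m tangent_map_coord F i j (c t))) => //.
  exact: pushE.
apply: smooth_on_mulmx.
- exact: open_dom.
- by apply: smooth_onS (sV i) => s [].
- exact: smooth_tangent_map_coord_curve.
Qed.

(** The right-hand side involves [V] only through its value and first derivative at [t], so fields
    that agree to first order have pushforwards that agree to first order. *)
Lemma derive1_push_field i j t : dom i j t ->
  derive1 (field_local pushV j) t =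
    field_local V i t *m 'D_1 (fun s : R^o => tangent_map_coord F i j (c s)) t
    + derive1 (field_local V i) t *m tangent_map_coord F i j (c t).
Proof.
move=> dt; rewrite !derive1E.
have dV : differentiable (field_local V i) t.
  by apply: (smooth_on_differentiable (sV i)); case: dt.
have dF := smooth_on_differentiable (smooth_tangent_map_coord_curve i j sF sc) dt.
apply: etrans (derive_mulmx (1 : R^o) dV dF).
apply/esym; apply: near_eq_derive.
have : nbhs t (dom i j) by apply: open_nbhs_nbhs; split => //; exact: open_dom.
by apply: filterS => s; exact: pushE.
Qed.

End Push.

Lemma omega_expand (D : connection M) i x u : chart_im (atlas i) x ->
  D i x u = \sum_k u 0 k *: D i x (delta_mx 0 k).
Proof.
move=> ix; pose L : {linear 'rV[R]_n -> 'M[R]_n} := HB.pack (D i x)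
  (GRing.isLinear.Build _ _ _ _ _ (omega_linear D ix)).
rewrite -[D i x]/(L : _ -> _) {1}[u]row_sum_delta linear_sum.
by apply: eq_bigr => k _; rewrite linearZ.
Qed.

(** Connection forms are smooth for each fixed direction; linearity reduces the moving velocity to
    the basis directions. *)
Lemma smooth_connection_curve (D : connection M) a b c i : smooth_curve a b c ->
  smooth_on (curve_dom a b c i) (fun t : R^o =>
    D i (atlas i (c t)) (derive1 (atlas i \o c) t)).
Proof.
move=> sc; have oS := open_curve_chart_dom (i := i) sc.
have sx := sc.2 i.
apply: (smooth_on_ext (f := \sum_k (fun t : R^o =>
    ('D_(1 : R^o) (atlas i \o c : R^o -> _) t 0 k : R^o)
      *: D i (atlas i (c t)) (delta_mx 0 k)))) => //.
  move=> t [_ it]; rewrite fct_sumE omega_expand; last by exists (c t).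
  by rewrite derive1E.
apply: smooth_on_sum => // k l.
apply: Ck_on_scale => //.
  by apply: Ck_on_entry => //; exact: (smooth_on_derive (1 : R^o) sx).
apply: (@Ck_on_comp _ _ _ _ l _ (chart_im (atlas i)) (atlas i \o c : R^o -> _)
  (fun x => D i x (delta_mx 0 k))) => //.
- by move=> t [_ it]; exists (c t).
- exact: omega_smooth.
Qed.

(** The transport equation is solved in the single chart around [c t0], on an interval on which the
    curve stays in it. That the equation also holds in every other chart is the gauge formula for
    the connection forms. *)
Lemma exists_parallel_field (D : connection M) a b c t0 (w : tangent (c t0)) :
  smooth_curve a b c -> a < t0 < b ->
  exists a' b', [/\ a <= a', a' < t0 < b', b' <= b &
    exists W : forall t, tangent (c t), W t0 = w /\ parallel_along D a' b' W].
Proof.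
move=> sc tab; pose i0 := chart_at (c t0).
have it0 : chart_dom (atlas i0) (c t0) by exact: mem_chart_at.
have dt0 : curve_dom a b c i0 t0 by split.
have oS := open_curve_chart_dom (i := i0) sc.
have [e e0 eS] : exists2 e : R, 0 < e & forall t, `|t - t0| < e -> curve_dom a b c i0 t.
  have /nbhs_ballP[e /= e0 eS] : nbhs t0 (curve_dom a b c i0) by apply: open_nbhs_nbhs.
  by exists e => // t te; apply: eS; rewrite -ball_normE /= distrC.
pose A t := - D i0 (atlas i0 (c t)) (derive1 (atlas i0 \o c) t).
have sA : smooth_on (curve_dom a b c i0) (A : R^o -> _).
  apply: (@smooth_on_lin _ _ _ _ _ -%R) => //; first exact: continuous_linear_mx.
  exact: smooth_connection_curve.
have cA t : `|t - t0| < e -> {for t, continuous A}.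
  by move=> /eS dt; exact: (smooth_on_continuous sA dt).
have [d [d0 de [v [vt0 dv]]]] := linear_ode (tangent_coord i0 w) e0 cA.
have inI t : t0 - d < t < t0 + d -> `|t - t0| < d by rewrite ltr_distl.
have inS t : t0 - d < t < t0 + d -> curve_dom a b c i0 t.
  by move=> /inI td; apply: eS; exact: lt_le_trans td de.
have itv_ab t : t0 - d < t < t0 + d -> a < t < b.
  by move=> /inS [+ _]; rewrite /= in_itv.
have sc' : smooth_curve (t0 - d) (t0 + d) c.
  split=> [t /itv_ab|i]; first exact: sc.1.
  apply: smooth_onS (sc.2 i) => t [/= td it].
  by split => //=; rewrite in_itv; apply: itv_ab.
pose W t : tangent (c t) := v t *m change i0 (chart_at (c t)) (c t).
have WE i t : curve_dom (t0 - d) (t0 + d) c i t ->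
    v t *m change i0 i (c t) = field_local W i t.
  move=> [td it]; have [_ i0t] := inS t td.
  rewrite /field_local /tangent_coord /W -mulmxA.
  by congr (_ *m _); exact/esym/(change_comp i0t (mem_chart_at (c t)) it).
have sv : smooth_on (`]t0 - d, t0 + d[ : set R^o) (v : R^o -> _).
  apply: (@smooth_on_ode_solution _ _ _ A); first exact: itv_open.
    by apply: smooth_onS sA => t /=; rewrite in_itv; exact: inS.
  by move=> t /=; rewrite in_itv => /inI; exact: dv.
have schange i : smooth_on (curve_dom (t0 - d) (t0 + d) c i)
    (fun t : R^o => change i0 i (c t)).
  apply: smooth_onS (smooth_tangent_map_coord_curve i0 i (smooth_map_id M) sc').
  by move=> t [td it]; do !split => //; have [] := inS t td.
have sW i : smooth_on (curve_dom (t0 - d) (t0 + d) c i) (field_local W i).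
  have oI := open_curve_chart_dom (i := i) sc'.
  refine (smooth_on_ext oI (@WE i) _).
  by apply: smooth_on_mulmx => //; apply: smooth_onS sv => t [].
have /andP[at0 t0b] := tab.
exists (t0 - d), (t0 + d); split.
(* Every time strictly between [t0 - d] and [t0 + d] lies strictly between [a] and [b]; otherwise
   [a] itself would be such a time. *)
- rewrite leNgt; apply/negP => da.
  have /itv_ab : t0 - d < a < t0 + d by rewrite da (lt_trans at0) // ltrDl.
  by rewrite ltxx.
- by rewrite ltrBlDr !ltrDl d0.
- rewrite leNgt; apply/negP => db.
  have /itv_ab : t0 - d < b < t0 + d by rewrite db (lt_trans _ t0b) // ltrBlDr ltrDl.
  by rewrite ltxx andbF.
exists W; split.
  rewrite /W vt0 /tangent_coord -mulmxA.
  apply: etrans (congr1 _ (change_comp it0 it0 it0)) _.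
  by apply: etrans (congr1 _ (change_id it0)) _; rewrite mulmx1.
split => // i t td it.
have dt : curve_dom (t0 - d) (t0 + d) c i t by split.
have [_ /= i0t] := inS t td.
pose tau := transition (atlas i0) (atlas i).
pose x : R^o -> 'rV[R]_n := atlas i0 \o c.
have ox : overlap (atlas i0) (atlas i) (x t) by exists (c t).
have dx : differentiable x t by apply: smooth_curve_differentiable sc' td i0t.
have tx : tau (x t) = atlas i (c t) by rewrite /tau /transition /x /= chart_mapK.
have dtau : differentiable tau (x t) by exact: transition_differentiable.
have E1 : derive1 (field_local W i) t
    = v t *m 'D_('D_(1 : R^o) x t) (jacobian tau) (x t) + (v t *m A t) *m 'J tau (x t).
  have [dv1 dvE] := dv t (inI t td).
  have dvt : differentiable (v : R^o -> _) t by apply: (smooth_on_differentiable sv).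
  have dC := smooth_on_differentiable (schange i) dt.
  rewrite derive1E -dvE.
  have dJ : differentiable (jacobian tau) (x t).
    apply: (smooth_on_differentiable (smooth_on_jacobian _ (atlas_compat i0 i))) => //.
    exact: open_overlap.
  rewrite -(derive_comp (1 : R^o) dx dJ).
  apply: etrans (derive_mulmx (1 : R^o) dvt dC).
  apply/esym; apply: near_eq_derive.
  have : nbhs t (curve_dom (t0 - d) (t0 + d) c i).
    by apply: open_nbhs_nbhs; split => //; exact: open_curve_chart_dom.
  by apply: filterS => s; exact: (@WE i s).
have E2 : derive1 (atlas i \o c) t = 'D_(1 : R^o) x t *m 'J tau (x t).
  rewrite derive1E -(deriveEjacobian _ dtau) -(derive_comp (1 : R^o) dx dtau).
  apply: near_eq_derive.
  have : nbhs t (curve_dom a b c i0) by apply: open_nbhs_nbhs; split => //; exact: inS.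
  by apply: filterS => s [_ /= i0s]; rewrite /tau /transition /x /= chart_mapK.
rewrite E1 -(WE i t dt) E2 -tx.
(* The gauge formula along the velocity cancels the derivative of the Jacobian against the two
   connection terms. *)
have G := omega_gauge D ('D_(1 : R^o) x t) ox.
have alg (y : 'rV[R]_n) (DJ J Om0 Omi : 'M[R]_n) : DJ + J *m Omi = Om0 *m J ->
    y *m DJ + (y *m - Om0) *m J + (y *m J) *m Omi = 0.
  move=> H; rewrite mulmxN mulNmx -!mulmxA -H mulmxDr opprD addrA subrr sub0r.
  by rewrite addNr.
by rewrite /A derive1E; exact: alg G.
Qed.

End ParallelFields.

(** * From K-V maps to coisotropic graphs *)


Section GraphAlgebra.
Variables (R : realType) (k n1 n2 : nat).
Variables (G : 'M[R]_(k, n1)) (S : 'M[R]_(n1, k)) (T : 'M[R]_(n1, n2)).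
Variables (h1 : 'M[R]_n1) (h2 : 'M[R]_n2).
Hypothesis SG : S *m G = 1%:M.

(* The rows of [row_mx G (G *m T)] span the graph of [T], whatever the         *)
(* dimension [k] of the manifold parametrizing it.                              *)
Lemma graph_coisotropicP :
  (forall a : 'cV[R]_(n1 + n2),
     (forall v : 'rV[R]_k, v *m row_mx G (G *m T) *m a = 0) ->
     exists v : 'rV[R]_k, v *m row_mx G (G *m T) = a^T *m block_mx h1 0 0 (- h2))
  <-> T^T *m h1 *m T = h2.
Proof.
split=> [H|E a aT].
  apply: row_mulmx_inj => u.
  (* These are the typical elements of the annihilator of the graph of [T]. *)
  have [v|v Hv] := H (col_mx (- (T *m u^T)) u^T).
    by rewrite mul_mx_row mul_row_col mulmxN !mulmxA addNr.
  move: Hv; rewrite mul_mx_row tr_col_mx mul_row_block !mulmx0 addr0 add0r.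
  move=> /eq_row_mx []; rewrite linearN /= trmx_mul trmxK => E1 E2.
  apply: oppr_inj; rewrite -[RHS]mulmxN -E2 (mulmxA v G T) E1.
  by rewrite !mulNmx !mulmxA.
(* Since [S *m G] is the identity, the rows [v *m G] exhaust all vectors, so an annihilating
   covector has this form. *)
have aE : usubmx a = - (T *m dsubmx a).
  apply/eqP; rewrite -addr_eq0; apply/eqP.
  apply: row_mulmx_inj => u; rewrite mulmx0 -[RHS](aT (u *m S)).
  rewrite -[in RHS](vsubmxK a) mul_mx_row mul_row_col !mulmxA.
  by rewrite -(mulmxA u S G) SG mulmx1 mulmxDr !mulmxA.
(* [S] lifts the required first component through [G]; the second component then matches by [aE] and
   the identity for [h2]. *)
exists ((usubmx a)^T *m h1 *m S).
rewrite -[in RHS](vsubmxK a) tr_col_mx mul_row_block !mulmx0 addr0 add0r.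
rewrite mul_mx_row mulmxA -[_ *m S *m G]mulmxA SG mulmx1; congr row_mx.
by rewrite aE linearN /= trmx_mul !mulNmx mulmxN -E !mulmxA.
Qed.

End GraphAlgebra.

Lemma bilin_mulmx (R : realType) m n (h : 'M[R]_m) (T : 'M[R]_(m, n)) a b :
  bilin h (T *m a) (T *m b) = bilin (T^T *m h *m T) a b.
Proof. by rewrite /bilin trmx_mul !mulmxA. Qed.

Lemma bilin_delta (R : realType) n (h : 'M[R]_n) i j :
  bilin h (delta_mx i 0) (delta_mx j 0) = h i j.
Proof. by rewrite /bilin trmx_delta -rowE -colE !mxE. Qed.

Section Graphs.
Context {R : realType} {n1 n2 : nat} {M1 : manifold R n1} {M2 : manifold R n2}.
Variables (D1 : connection M1) (D2 : connection M2).
Variables (h1 : bivector M1) (h2 : bivector M2).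
Variables (F : M1 -> M2) (smF : smooth_map F).

Let DP := prod_connection D1 D2.
Let hP := prod_bivector h1 (opp_bivector h2).

Definition preserves_bivector := forall p,
  (tangent_map F p)^T *m h1 p *m tangent_map F p = h2 (F p).

Lemma preserves_bivectorP : preserves_bivector <->
  forall (a b : one_form M2) p,
    bilin (h1 p) (pullback (a (F p))) (pullback (b (F p)))
    = bilin (h2 (F p)) (a (F p)) (b (F p)).
Proof.
split=> [H a b p|H p].
  by rewrite /pullback bilin_mulmx H.
apply/matrixP => i j.
have [a aE] := one_form_through (delta_mx i 0 : cotangent (F p)).
have [b bE] := one_form_through (delta_mx j 0 : cotangent (F p)).
by have := H a b p; rewrite aE bE /pullback bilin_mulmx !bilin_delta.
Qed.

Lemma affine_map_graph_map : affine_map D1 D2 F -> affine_map D1 DP (graph_map F).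
Proof.
move=> [_ affF]; split; first exact: smooth_graph_map.
move=> a b c V sc pV.
have pFV := affF a b c V sc pV.
have sFc := smooth_curve_comp smF sc.
have := (parallel_along_prod D1 D2 V (fun t => push F (V t)) sc sFc).2
  (conj pV pFV).
by apply: parallel_along_ext => // t; exact/esym/push_graph_map.
Qed.

Lemma kv_map_coisotropic : affine_structure D1 ->
  kv_map D1 h1 D2 h2 F -> coisotropic_kv_submanifold DP hP (graph F).
Proof.
move=> affD1 [affF hF].
(* The graph carries the affine structure of [M1], and [graph_coisotropicP] is used with [G] and [S]
   both the identity. *)
exists n1, M1, D1, (graph_map F); split.
- split => //; first exact: submanifold_inclusion_graph_map.
  exact: affine_map_graph_map.
- exact: range_graph_map.
move=> p _ [a aT <-].
have E := (preserves_bivectorP.2 hF) p.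
have [|v Hv] := (graph_coisotropicP (tangent_map F p) (h1 p) (h2 (F p))
  (mul1mx (1%:M : 'M[R]_n1))).2 E a.
  move=> v; rewrite mul_mx_row mulmx1 mul1mx.
  have := aT _ (ex_intro2 _ _ (v : tangent p) I erefl).
  by rewrite (push_graph_map smF).
exists v => //; rewrite (push_graph_map smF); apply: (etrans _ Hv).
by rewrite mul_mx_row mulmx1 mul1mx.
Qed.

End Graphs.

(** * From coisotropic graphs to K-V maps *)


Section SubmanifoldFactorization.
Context {R : realType} {k l n : nat}.
Context {N : manifold R k} {L : manifold R l} {M : manifold R n}.
Variables (iota : N -> M) (s : L -> N).
Hypotheses (sub : submanifold_inclusion iota) (sf : smooth_map (iota \o s)).

Let proj : 'M[R]_(n, k) := pid_mx k.

Let projK (x : 'rV[R]_k) : x *m pid_mx k *m proj = x.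
Proof.
case: sub => kn _ _; rewrite -mulmxA mul_pid_mx minnn (minn_idPr kn).
by rewrite pid_mx_1 mulmx1.
Qed.

Let slice (p : L) : exists (phi : chart R n M) (psi : chart R k N),
  [/\ admissible phi, admissible psi, chart_dom phi (iota (s p)),
      (forall q, chart_dom psi q <-> chart_dom phi (iota q)) &
      (forall q, chart_dom psi q -> psi q = phi (iota q) *m proj)].
Proof.
case: sub => _ _ /(_ (s p)) [phi [psi [[aphi apsi] dp dE slE _]]].
exists phi, psi; split => // [q|q dq]; first by rewrite dE.
by rewrite slE // projK.
Qed.

(** Near [p], [s] equals the inverse of the slice chart [psi] after a projection of [iota \o s] read
    in [phi]. This uses that the domain of [psi] is the full preimage of that of [phi]. *)
Let continuous_factor : continuous s.
Proof.
move=> p; have [phi [psi [_ _ dp dE sE]]] := slice p.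
have cf : {for p, continuous (iota \o s)} by case: sf => cf _; exact: cf.
pose h := chart_inv psi \o (mulmxr proj \o (phi \o (iota \o s))).
have E q : chart_dom phi (iota (s q)) -> h q = s q.
  by move=> /dE dq; rewrite /h /= -sE // chart_mapK.
have nE : {near p, h =1 s}.
  have : nbhs p ((iota \o s) @^-1` chart_dom phi).
    by apply: cf; apply: open_nbhs_nbhs; split => //; exact: chart_dom_open.
  by apply: filterS => q; exact: E.
have ch : {for p, continuous h}.
  apply: continuous_comp; last first.
    by apply: chart_inv_cont; rewrite /= -sE; [exists (s p) => //|]; exact/dE.
  apply: continuous_comp; last exact: continuous_linear_mx.
  by apply: continuous_comp => //; exact: chart_map_cont.
move: ch; rewrite /prop_for /continuous_at E // => ch.
apply: cvg_trans ch; apply: near_eq_cvg; apply: filterS nE => q.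
by [].
Qed.

(* In a slice chart around [iota (s p)], [s] is the projection of [iota \o s]   *)
(* to the first [k] coordinates.                                                *)
Lemma smooth_map_factor : smooth_map s.
Proof.
have cs := continuous_factor; have [cf rf] := sf.
split=> // i j.
apply: (@smooth_rep_comp R l k k L N N (atlas i) (atlas j) s id) => //.
  by move=> x; exact: cvg_id.
move=> p ip jp; have [phi [psi [aphi apsi dp dE sE]]] := slice p.
exists psi; split; [exact/dE| |by have [] := apsi j].
have sphi : smooth_rep (atlas i) phi (iota \o s).
  apply: (@smooth_rep_comp R l n n L M M (atlas i) phi (iota \o s) id) => //.
    by move=> x; exact: cvg_id.
  move=> q iq phiq; exists (atlas (chart_at (iota (s q)))).
  split; [exact: mem_chart_at|exact: rf|by have [] := aphi (chart_at (iota (s q)))].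
have domE : rep_dom (atlas i) psi s = rep_dom (atlas i) phi (iota \o s).
  by apply/seteqP; split => _ [q [iq dq] <-]; exists q => //; split => //; apply/dE.
have oD := open_rep_dom (phi := atlas i) (psi := psi) cs.
apply: (smooth_on_ext (f := mulmxr proj \o rep (atlas i) phi (iota \o s))) => //.
  by move=> _ [q [iq dq] <-]; rewrite /rep /= chart_mapK // sE.
apply: smooth_on_lin => //; first exact: continuous_linear_mx.
by rewrite domE.
Qed.

End SubmanifoldFactorization.

Section GraphSubmanifold.
Context {R : realType} {n1 n2 : nat} {M1 : manifold R n1} {M2 : manifold R n2}.
Variables (D1 : connection M1) (D2 : connection M2).
Variables (h1 : bivector M1) (h2 : bivector M2).
Variables (F : M1 -> M2) (smF : smooth_map F).

Let P := prod_manifold M1 M2.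
Let DP := prod_connection D1 D2.
Let hP := prod_bivector h1 (opp_bivector h2).

Variables (k : nat) (N : manifold R k) (DN : connection N) (iota : N -> P).
Hypotheses (sub : submanifold_inclusion iota) (aff : affine_map DN DP iota).
Hypothesis rg : range iota = graph F.

Let g : N -> M1 := fst \o iota.

Let iotaE : iota = fun q => (g q, (F \o g) q).
Proof.
apply/funext => q; have : graph F (iota q) by rewrite -rg; exists q.
by rewrite /graph /= /g /=; case: (iota q) => a b /= ->.
Qed.

Let sg : smooth_map g.
Proof. exact: smooth_map_comp aff.1 (smooth_map_fst M1 M2). Qed.

(** Only a choice of preimages; its smoothness comes afterwards from [smooth_map_factor]. *)
Lemma graph_section : exists s : M1 -> N, iota \o s = graph_map F.
Proof.
have /choice [s sE] p : exists q, iota q = graph_map F p.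
  have : graph F (graph_map F p) by [].
  by rewrite -rg => -[q _ qE]; exists q.
by exists s; apply/funext.
Qed.

Variable s : M1 -> N.
Hypothesis sE : iota \o s = graph_map F.

Let ss : smooth_map s.
Proof. by apply: (smooth_map_factor sub); rewrite sE; exact: smooth_graph_map. Qed.

Let gs p : g (s p) = p.
Proof. by have := congr1 (fun f => (f p).1) sE. Qed.

(** Differentiates [g \o s = id]. It supplies the matrix [S] of [graph_coisotropicP], so that no
    comparison of [k] with [n1] has to be made. *)
Let SG p : tangent_map s p *m tangent_map g (s p) = 1%:M.
Proof.
rewrite -(tangent_map_comp p ss sg).
have -> : g \o s = id by apply/funext.
exact: tangent_map_id.
Qed.

Let tangent_iota q : tangent_map iota q
  = row_mx (tangent_map g q) (tangent_map g q *m tangent_map F (g q)).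
Proof.
rewrite iotaE (tangent_map_pair sg (smooth_map_comp sg smF)).
by rewrite (tangent_map_comp q sg smF).
Qed.

Lemma coisotropic_preserves_bivector :
  (forall q : N, sharp (hP (iota q)) @` annihilator (@tangent_of _ _ P _ _ iota q)
                 `<=` @tangent_of _ _ P _ _ iota q) ->
  preserves_bivector h1 h2 F.
Proof.
move=> coiso p.
apply: (graph_coisotropicP (tangent_map F p) (h1 p) (h2 (F p)) (SG p)).1 => a aT.
have iotap : iota (s p) = (p, F p) by have := congr1 (fun f => f p) sE.
have TE : tangent_map iota (s p) = row_mx (tangent_map g (s p))
    (tangent_map g (s p) *m tangent_map F p).
  by rewrite tangent_iota gs.
have aN : annihilator (@tangent_of _ _ P _ _ iota (s p)) a.
  by move=> _ [v _ <-]; rewrite /push TE; exact: aT.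
have [v _ vE] := coiso (s p) _ (ex_intro2 _ _ a aN erefl).
exists v; rewrite -TE; apply: (etrans vE).
by rewrite /sharp /hP /= /prod_bivector_at iotap.
Qed.

Lemma affine_map_of_graph : affine_map D1 D2 F.
Proof.
split=> // a b c V sc [sV pV].
split=> [j|j t0 tab jt0]; first exact: smooth_push_field.
have sgam := smooth_curve_comp ss sc.
(* The initial value is the image of [V t0] under the differential of [s], so that the differential
   of [g] gives back [V t0]. *)
have [a' [b' [aa tab' bb [W [W0 pW]]]]] := exists_parallel_field DN
  (c := s \o c) (t0 := t0) (V t0 *m tangent_map s (c t0)) sgam tab.
pose X t : tangent (c t) := W t *m tangent_map g (s (c t)).
have sc' := smooth_curveS aa bb sc.
have pX : parallel_along D1 a' b' X /\
    @parallel_along _ _ _ D2 a' b' (F \o c) (fun t => push F (X t)).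
  apply/(parallel_along_prod D1 D2 X (fun t => push F (X t)) sc'
    (smooth_curve_comp smF sc')).
  (* The affine map [iota] sends [W] to a parallel field along the graph, whose components are [X]
     and its image under dF. *)
  have := aff.2 a' b' _ W (smooth_curveS aa bb sgam) pW.
  apply: parallel_along_ext => [|t].
    by apply/funext => t; exact: (congr1 (fun f : M1 -> P => f (c t)) sE).
  by rewrite /push tangent_iota gs mul_mx_row mulmxA.
have X0 : X t0 = V t0 by rewrite /X W0 -mulmxA SG mulmx1.
pose i := chart_at (c t0).
have it0 : chart_dom (atlas i) (c t0) by exact: mem_chart_at.
have [[sX eX] [_ eFX]] := pX.
have XV : field_local X i t0 = field_local V i t0 by rewrite /field_local X0.
have FXV : field_local (fun t => push F (X t)) j t0
    = field_local (fun t => push F (V t)) j t0 by rewrite /field_local X0.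
(* Both fields solve the same first-order equation along [c] at [t0] and agree there, so their
   derivatives agree as well. *)
have dXV : derive1 (field_local X i) t0 = derive1 (field_local V i) t0.
  have e1 := eX i t0 tab' it0; have e2 := pV i t0 tab it0.
  by apply: (addIr _ (etrans e1 (esym _))); rewrite -XV in e2.
have dFXV : derive1 (field_local (fun t => push F (X t)) j) t0
    = derive1 (field_local (fun t => push F (V t)) j) t0.
  have d1 : (curve_dom a' b' c i `&` (F \o c) @^-1` chart_dom (atlas j)) t0 by [].
  have d2 : (curve_dom a b c i `&` (F \o c) @^-1` chart_dom (atlas j)) t0 by [].
  have E1 := derive1_push_field smF sc' sX d1.
  have E2 := derive1_push_field smF sc sV d2.
  by apply: etrans E1 (etrans _ (esym E2)); rewrite XV dXV.
have := eFX j t0 tab' jt0.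
by rewrite FXV dFXV.
Qed.

End GraphSubmanifold.

Theorem proposition7p5 (R : realType) (n1 n2 : nat)
    (M1 : manifold R n1) (M2 : manifold R n2)
    (D1 : connection M1) (D2 : connection M2)
    (h1 : bivector M1) (h2 : bivector M2)
    (kv1 : koszul_vinberg D1 h1) (kv2 : koszul_vinberg D2 h2)
    (F : M1 -> M2) (smF : smooth_map F) :
  kv_map D1 h1 D2 h2 F <->
  coisotropic_kv_submanifold
    (prod_connection D1 D2) (prod_bivector h1 (opp_bivector h2)) (graph F).
Proof.
split=> [|[k [N [DN [iota [[sub _ aff] rg coiso]]]]]].
  exact: kv_map_coisotropic kv1.1.
have [s sE] := graph_section rg.
split; first exact: (affine_map_of_graph smF sub aff rg sE).
apply/preserves_bivectorP.
exact: (coisotropic_preserves_bivector smF sub aff rg sE coiso).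
Qed.
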